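(* Let $z>0$ and $\gamma\in\mathbb R$, let $n$ be even, and let $\kappa,u,r,p,q,C_{n,k},\mathcal Z_n,A,B,\mathcal I_{z,\gamma}$ be as defined in the context. Define probability measures on $\mathbb R$ by $$\nu_n:=\frac1{\mathcal Z_n(1)}\sum_{\ell=-\kappa}^{\kappa}C_{n,\kappa+\ell}\,\delta_{\ell/n^{3/4}},\qquad d\nu_{z,\gamma}(x):=\frac1{\mathcal I_{z,\gamma}(0)}\exp\!\left(\gamma x^2-\frac{B(z)}{12}x^4\right)dx,$$ where $\delta_x$ is the unit point mass at $x$. Then, as $n\to\infty$ through even integers, for every compact set $\Omega\subset\mathbb C$, $$\sup_{\zeta\in\Omega}\left|\int_{\mathbb R}e^{\zeta x}\,d\nu_n(x)-\int_{\mathbb R}e^{\zeta x}\,d\nu_{z,\gamma}(x)\right|\longrightarrow0 .$$ In particular, for every $s\in\mathbb R$, $$\int_{\mathbb R}e^{isx}\,d\nu_n(x)\longrightarrow\int_{\mathbb R}e^{isx}\,d\nu_{z,\gamma}(x).$$ Consequently, $\nu_n$ converges weakly to $\nu_{z,\gamma}$. Equivalently, if $K_n$ is a random variable on $\{0,1,\dots,n\}$ with law $\mathbb P_n(K_n=k)=C_{n,k}/\mathcal Z_n(1)$, if $\mathbb E_n$ denotes expectation with respect to $\mathbb P_n$, and if $M_n=n-2K_n$, then $$\mathbb E_n\exp\!\left(\tau\frac{M_n}{n^{3/4}}\right)\longrightarrow\frac{\mathcal I_{z,\gamma}(-2\tau)}{\mathcal I_{z,\gamma}(0)}$$ locally uniformly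 for $\tau\in\mathbb C$.
   Context: For $0\le k\le n$, the $(p,q)$-binomial coefficient is $$\binom{n}{k}_{p,q}:=\prod_{j=1}^{k}\frac{p^{\,n-k+j}-q^{\,n-k+j}}{p^j-q^j}.$$ For $z>0$ define $$A(z):=z\left(\coth\frac z4-1\right),\qquad B(z):=\frac{z^3\sinh(z/2)}{8\sinh^4(z/4)}>0.$$ For an even positive integer $n$, put $$\kappa:=\frac n2,\quad r:=e^{-z/n},\quad u:=\frac{A(z)}2+\frac{\gamma}{\sqrt n},\quad p:=e^{-u/n},\quad q:=pr=e^{-(u+z)/n},$$ $$C_{n,k}:=\binom{n}{k}_{p,q},\quad P_n(w):=\sum_{k=0}^nC_{n,k}w^k,\quad \mathcal Z_n(w):=w^{-\kappa}P_n(w)\ (w\ne0),$$ so that $\mathcal Z_n(1)=\sum_{k=0}^nC_{n,k}$, and $$\mathcal I_{z,\gamma}(\zeta):=\int_{-\infty}^{\infty}\exp\!\left(\zeta x+\gamma x^2-\frac{B(z)}{12}x^4\right)dx,\qquad\zeta\in\mathbb C.$$ *)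

(* Defs.v *)
From HB Require Import structures.
From mathcomp Require Import all_boot all_order all_algebra.
From mathcomp Require Import complex.
From mathcomp Require Import all_classical all_reals all_analysis.
From mathcomp Require Import measurable_realfun.

Set Implicit Arguments.
Unset Strict Implicit.
Unset Printing Implicit Defensive.
Import Order.TTheory GRing.Theory Num.Theory.
Import numFieldNormedType.Exports.

Local Open Scope classical_set_scope.
Local Open Scope ring_scope.
Local Open Scope complex_scope.

(* The usual topology and norm of C = R[i]. The modulus `|w| is R[i]-valued,
   with zero imaginary part; complex.Re `|w| is the modulus as an element of
   R. *)
HB.instance Definition _ (R : realType) := NormedModule.copy R[i] (R[i])^o.

Section complex_functions.
Context {R : realType}.

Definition cexp (w : R[i]) : R[i] :=
  (expR (complex.Re w) * cos (complex.Im w))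
  +i* (expR (complex.Re w) * sin (complex.Im w)).

Definition cintegral d (T : measurableType d)
    (mu : {measure set T -> \bar R}) (f : T -> R[i]) : R[i] :=
  (\int[mu]_x complex.Re (f x)) +i* (\int[mu]_x complex.Im (f x)).

(* sup over Omega of |f|, taken in [0, +oo]: inserting 0 only matters for
   Omega = set0, where the supremum is then 0 instead of -oo. *)
Definition sup_modulus (Omega : set R[i]) (f : R[i] -> R[i]) : \bar R :=
  ereal_sup (0%E |` [set (complex.Re `|f w|)%:E | w in Omega]).

Definition sinh (x : R) : R := (expR x - expR (- x)) / 2.
Definition cosh (x : R) : R := (expR x + expR (- x)) / 2.
Definition coth (x : R) : R := cosh x / sinh x.

End complex_functions.

Definition even_infty : set_system nat := within [set n | ~~ odd n] \oo.

Definition locally_uniformly_cvg {R : realType}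
    (F : set_system nat) (f : nat -> R[i] -> R[i]) (g : R[i] -> R[i]) : Prop :=
  forall w : R[i], exists2 U : set R[i], nbhs w U & {uniform U, f @ F --> g}.

Definition weakly_cvg {R : realType} (F : set_system nat)
    (mu : nat -> {measure set R -> \bar R}) (nu : {measure set R -> \bar R}) :
    Prop :=
  forall f : R -> R, continuous f -> (exists M : R, forall x, `|f x| <= M) ->
    \int[mu n]_x f x @[n --> F] --> \int[nu]_x f x.

Section model.
Context {R : realType}.
Implicit Types (z gamma : R) (n k : nat).

Definition pq_binomial (p q : R) n k : R :=
  \prod_(1 <= j < k.+1)
    ((p ^+ (n - k + j) - q ^+ (n - k + j)) / (p ^+ j - q ^+ j)).

Definition coefA z : R := z * (coth (z / 4) - 1).

Definition coefB z : R := z ^+ 3 * sinh (z / 2) / (8 * sinh (z / 4) ^+ 4).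

Definition param_u z gamma n : R := coefA z / 2 + gamma / Num.sqrt n%:R.

Definition param_r z n : R := expR (- z / n%:R).

Definition param_p z gamma n : R := expR (- param_u z gamma n / n%:R).

Definition param_q z gamma n : R := param_p z gamma n * param_r z n.

Definition pqC z gamma n k : R :=
  pq_binomial (param_p z gamma n) (param_q z gamma n) n k.

Definition polyP z gamma n : {poly R} := \poly_(k < n.+1) pqC z gamma n k.

(* For even n, with kappa = n./2; only real arguments w are needed. *)
Definition partZ z gamma n (w : R) : R := w ^- n./2 * (polyP z gamma n).[w].

Definition quartic z gamma (x : R) : R :=
  gamma * x ^+ 2 - coefB z / 12 * x ^+ 4.

Definition integralI z gamma (zeta : R[i]) : R[i] :=
  cintegral lebesgue_measure
    (fun x : R => cexp (zeta * x%:C + (quartic z gamma x)%:C)).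

Lemma pq_binomial_ge0 (p q : R) n k :
  0 <= p -> 0 <= q -> 0 <= pq_binomial p q n k.
Proof.
move=> p0 q0; rewrite /pq_binomial; apply: prodr_ge0 => j _.
have [qp|/ltW pq] := leP q p.
  by rewrite divr_ge0// subr_ge0 lerXn2r// nnegrE.
by rewrite -mulrNN -invrN !opprB divr_ge0// subr_ge0 lerXn2r// nnegrE.
Qed.

Lemma pqC_ge0 z gamma n k : 0 <= pqC z gamma n k.
Proof. by rewrite pq_binomial_ge0// ?mulr_ge0// expR_ge0. Qed.

Lemma polyP1_ge0 z gamma n : 0 <= (polyP z gamma n).[1].
Proof.
rewrite horner_poly; apply: sumr_ge0 => k _.
by rewrite expr1n mulr1 pqC_ge0.
Qed.

Definition weight z gamma n k : R := pqC z gamma n k / partZ z gamma n 1.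

Lemma weight_ge0 z gamma n k : 0 <= weight z gamma n k.
Proof.
by rewrite divr_ge0 ?pqC_ge0// /partZ mulr_ge0 ?polyP1_ge0// invr_ge0 expr1n.
Qed.

(* The sum is indexed by k = kappa + l in {0, ..., n}, so the atom attached to
   k is at l / n^(3/4) = (k - kappa) / n^(3/4). *)
Definition nu_n z gamma n : {measure set R -> \bar R} :=
  msum (fun k => mscale (NngNum (weight_ge0 z gamma n k))
                        (dirac ((k%:R - n./2%:R) / n%:R `^ (3 / 4)))) n.+1.

(* integralI z gamma 0 is real; its real part is used as an element of R. *)
Definition nu_density z gamma (x : R) : R :=
  (complex.Re (integralI z gamma 0))^-1 * expR (quartic z gamma x).

Lemma nu_density_ge0 z gamma x : 0 <= nu_density z gamma x.
Proof.
rewrite mulr_ge0 ?expR_ge0// invr_ge0 /= fine_ge0//.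
apply: integral_ge0 => y _; rewrite lee_fin.
by rewrite /cexp /= !mul0r !addr0 cos0 mulr1 expR_ge0.
Qed.

Lemma measurable_nu_density z gamma :
  measurable_fun [set: R] (nu_density z gamma).
Proof.
apply: measurable_funM => //; apply: measurableT_comp => //.
by apply: measurable_funB; apply: measurable_funM => //; exact: measurable_funX.
Qed.

Definition nu_lim z gamma (X : set R) : \bar R :=
  (\int[lebesgue_measure]_(x in X) (nu_density z gamma x)%:E)%E.

Let nu_lim0 z gamma : nu_lim z gamma set0 = 0%E.
Proof. exact: integral_set0. Qed.

Let nu_lim_ge0 z gamma X : (0 <= nu_lim z gamma X)%E.
Proof. by apply: integral_ge0 => x _; rewrite lee_fin nu_density_ge0. Qed.

Let nu_lim_sigma_additive z gamma : semi_sigma_additive (nu_lim z gamma).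
Proof.
move=> /= X mX tX mUX; rewrite /nu_lim ge0_integral_bigcup//; last 2 first.
- apply: measurable_funTS; apply/measurable_EFinP.
  exact: measurable_nu_density.
- by move=> x _; rewrite lee_fin nu_density_ge0.
apply: is_cvg_ereal_nneg_natsum_cond => n _ _.
by apply: integral_ge0 => x _; rewrite lee_fin nu_density_ge0.
Qed.

HB.instance Definition _ z gamma := isMeasure.Build _ _ _ (nu_lim z gamma)
  (nu_lim0 z gamma) (@nu_lim_ge0 z gamma) (@nu_lim_sigma_additive z gamma).

End model.

(* Main.v *)
Require Import Defs.
From HB Require Import structures.
From mathcomp Require Import all_boot all_order all_algebra.
From mathcomp Require Import complex.
From mathcomp Require Import all_classical all_reals all_analysis.
From mathcomp Require Import measurable_realfun.
From mathcomp Require Import ring lra zify.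

Set Implicit Arguments.
Unset Strict Implicit.
Unset Printing Implicit Defensive.
Import Order.TTheory GRing.Theory Num.Theory.
Import numFieldNormedType.Exports.

Local Open Scope classical_set_scope.
Local Open Scope ring_scope.
Local Open Scope complex_scope.

(** Write n = 2k, h = n^(-3/4) and w_l = C(n,k+l) / C(n,k).

    Since p^m - q^m = p^m (1 - r^m), consecutive coefficients have an explicit
    ratio, and with L(t) = ln (1 - e^-t)
      w_(i+1) / w_i = exp ((2i+1) u/n + L(b - y_i) - L(b + y_i)),
    where b = z (n+1) / (2n) and y_i = z (2i+1) / (2n); the same recurrence
    runs downwards, so w_(-l) = w_l.  The midpoint b makes the difference odd
    in y, so its expansion is -2 L'(b) y - L'''(b) y^3/3 - ....  As
    2 L'(b) y_i = (2i+1)/n * z/(e^b - 1), and u is tuned to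
    z/(e^(z/2) - 1) + gamma / sqrt n, the first order terms cancel up to
    gamma.  Summing over i < l with sum (2i+1) = l^2 and
    sum (2i+1)^3 = 2 l^4 - l^2 gives, at x = l h,
      ln w_l -> gamma x^2 - (z^3 L'''(z/2) / 12) x^4,
    and z^3 L'''(z/2) is the constant B(z).

    The expansion is made effective by the derivative of the gap
    G(y) = L(b - y) - L(b + y), which is rational in e^b and cosh y
    (gap_slopeE).  It yields a cubic upper bound valid up to the
    singularity y = b (log_gap_le), and a matching lower bound near 0, up to a
    factor that tends to 1 (log_gap_ge).  The first one dominates every w_l,
    |l| <= k, by a multiple of e^(-2 x^2 - M |x|) (log_ratio_dominated); the
    two together give the pointwise limit (cvg_log_ratio).

    A sum over the atoms is the Lebesgue integral of a step function, so both
    the partition function and the integrals of test functions converge by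
    dominated convergence.  For the exponentials e^(zeta x) the error at each
    point is at most a function (defect) depending only on a bound M of |zeta|
    (step_defect): this is what makes the convergence uniform on compact sets
    (mgf_rate).  The characteristic functions are the imaginary values of
    zeta, the magnetization corresponds to zeta = -2 tau, and weak convergence
    is one more application of dominated convergence (atomic_weak). *)

(** * Odd increments of ln (1 - e^-t) *)

Section elementary.
Context {R : realType}.
Implicit Types (b y t x : R).

Lemma derive_ge0_le (f f' : R -> R) y : 0 <= y ->
  (forall x, 0 <= x <= y -> is_derive x 1 f (f' x)) ->
  (forall x, 0 <= x <= y -> 0 <= f' x) -> f 0 <= f y.
Proof.
move=> y0 df f'0.
have I x : x \in `]0, y[%R -> 0 <= x <= y.
  by rewrite in_itv/= => /andP[x0 xy]; rewrite !ltW.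
apply: (@ger0_derive1_le_cc _ f 0 y) => //.
- by move=> x /I/df ?; exact: ex_derive.
- by move=> x /I xI; rewrite derive1E (@derive_val _ _ _ _ _ _ _ (df x xI)) f'0.
- apply: derivable_within_continuous => x; rewrite in_itv/= => /df ?.
  exact: ex_derive.
- by rewrite in_itv/= lexx.
- by rewrite in_itv/= lexx andbT.
Qed.

Lemma is_derive_addl b x : is_derive x 1 (fun s => b + s) (1 : R).
Proof. by rewrite -[X in is_derive _ _ _ X]add0r; exact: is_deriveD. Qed.

Lemma cosh_ge1 t : 1 <= cosh t :> R.
Proof.
rewrite /cosh expRN; have := expR_gt0 t; set e := expR t => e0.
rewrite ler_pdivlMr// -subr_ge0.
have -> : e + e^-1 - 1 * 2 = (e - 1) ^+ 2 / e by field; rewrite gt_eqF.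
by rewrite divr_ge0 ?sqr_ge0// ltW.
Qed.

Lemma is_derive_sinh t : is_derive t 1 (@sinh R) (cosh t).
Proof.
rewrite /sinh /cosh; apply: is_derive_eq.
by rewrite /GRing.scale/=; field.
Qed.

Lemma is_derive_cosh t : is_derive t 1 (@cosh R) (sinh t).
Proof.
rewrite /sinh /cosh; apply: is_derive_eq.
by rewrite /GRing.scale/=; field.
Qed.

Lemma sinh0 : sinh 0 = 0 :> R.
Proof. by rewrite /sinh oppr0 subrr mul0r. Qed.

Lemma sinh_ge t : 0 <= t -> t <= sinh t.
Proof.
move=> t0; rewrite -subr_ge0.
have <- : sinh 0 - 0 = 0 :> R by rewrite sinh0 subr0.
apply: (@derive_ge0_le (fun x => sinh x - x) (fun x => cosh x - 1)) => // x _.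
  by have ? := is_derive_sinh x; apply: is_derive_eq.
by rewrite subr_ge0 cosh_ge1.
Qed.

Lemma sinh_le t : 0 <= t -> sinh t <= t * cosh t.
Proof.
move=> t0; rewrite -subr_ge0.
have <- : 0 * cosh 0 - sinh 0 = 0 :> R by rewrite sinh0 mul0r subr0.
apply: (@derive_ge0_le (fun x => x * cosh x - sinh x) (fun x => x * sinh x))
    => // x /andP[x0 _].
  have ? := is_derive_sinh x; have ? := is_derive_cosh x.
  by apply: is_derive_eq; rewrite /GRing.scale/= mulr1; lra.
by rewrite mulr_ge0// (le_trans x0)// sinh_ge.
Qed.

Lemma cosh_le x y : 0 <= x -> x <= y -> cosh x <= cosh y :> R.
Proof.
move=> x0 xy; have yx : 0 <= y - x by rewrite subr_ge0.
have := @derive_ge0_le (fun s => cosh (x + s)) (fun s => sinh (x + s)) _ yx.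
rewrite addr0 (addrC x) subrK; apply=> s /andP[s0 _].
  have ? := is_derive_cosh (x + s).
  rewrite -[X in is_derive _ _ _ X]mulr1.
  apply: (@is_derive1_comp _ (@cosh R) (fun s => x + s)).
  exact: is_derive_addl.
by have sx : 0 <= x + s := addr_ge0 x0 s0; apply: (le_trans sx); exact: sinh_ge.
Qed.

Lemma cosh1E y : cosh y - 1 = 2 * sinh (y / 2) ^+ 2 :> R.
Proof.
rewrite /cosh /sinh (splitr y) opprD !expRD -(splitr y) !expRN.
have := expR_gt0 (y / 2); set e := expR _ => e0.
by field; rewrite gt_eqF.
Qed.

Lemma cosh1_ge y : 0 <= y -> y ^+ 2 / 2 <= cosh y - 1.
Proof.
move=> y0; rewrite cosh1E.
have y20 : 0 <= y / 2 by rewrite divr_ge0.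
have : (y / 2) ^+ 2 <= sinh (y / 2) ^+ 2.
  by rewrite lerXn2r// ?nnegrE// ?sinh_ge// (le_trans y20)// sinh_ge.
by rewrite expr_div_n; lra.
Qed.

(** The lower bound y^2 / 2 on cosh y - 1 is sharp at 0: the factor lost here,
    a squared cosh on a bounded range, tends to 1 as the range shrinks. *)
Lemma cosh1_le x y : 0 <= x -> x <= y ->
  cosh x - 1 <= x ^+ 2 / 2 * cosh (y / 2) ^+ 2.
Proof.
move=> x0 xy; rewrite cosh1E.
have x20 : 0 <= x / 2 by rewrite divr_ge0.
have h : sinh (x / 2) <= x / 2 * cosh (y / 2).
  by rewrite (le_trans (sinh_le x20))// ler_wpM2l// cosh_le// ler_pM2r.
have : sinh (x / 2) ^+ 2 <= (x / 2 * cosh (y / 2)) ^+ 2.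
  rewrite lerXn2r// nnegrE ?(le_trans x20)// ?sinh_ge//.
  by rewrite ler_peMr// cosh_ge1.
by rewrite [in leRHS]exprMn (expr_div_n x); lra.
Qed.

(** With q^m = e^-t, this is the logarithm of the factor 1 - q^m of a Gaussian
    binomial coefficient. *)
Definition lnq t : R := ln (1 - expR (- t)).

Lemma is_derive_lnq t : 0 < t -> is_derive t 1 lnq (expR t - 1)^-1.
Proof.
move=> t0.
have e1 : 0 < 1 - expR (- t) by rewrite subr_gt0 expR_lt1 oppr_lt0.
have := is_derive1_ln e1 => ?.
have -> : (expR t - 1)^-1 = (1 - expR (- t))^-1 * expR (- t).
  have ? : 0 < expR t - 1 by rewrite subr_gt0 expR_gt1.
  rewrite expRN in e1 *; have e0 := expR_gt0 t; field.
  by rewrite !gt_eqF//= subr_gt0 -invf_lt1//; lra.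
apply: (@is_derive1_comp _ (@ln R) (fun s => 1 - expR (- s))).
by apply: is_derive_eq; rewrite /GRing.scale/=; lra.
Qed.

(** One step away from the middle coefficient changes its logarithm by a
    difference of this form.  Being odd in y, it has no quadratic term. *)
Definition log_gap b y : R := lnq (b - y) - lnq (b + y).

Lemma is_derive_log_gap b y : 0 <= y -> y < b ->
  is_derive y 1 (log_gap b) (- (expR (b - y) - 1)^-1 - (expR (b + y) - 1)^-1).
Proof.
move=> y0 yb.
have := @is_derive_lnq (b - y); rewrite subr_gt0 => /(_ yb) d1.
have := @is_derive_lnq (b + y); rewrite ltr_wpDr// => [/(_ isT) d2|]; last first.
  by rewrite (le_lt_trans y0).
apply: is_deriveB.
  rewrite -[X in is_derive _ _ _ X]mulrN1.
  apply: (@is_derive1_comp _ lnq (fun y => b - y)).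
  by rewrite -[X in is_derive _ _ _ X]add0r; exact: is_deriveB.
rewrite -[X in is_derive _ _ _ X]mulr1.
by apply: (@is_derive1_comp _ lnq (fun y => b + y)); exact: is_derive_addl.
Qed.

(** The slope of the gap is a rational function of e^b and cosh y with this
    denominator; cosh y - 1 is kept as a block because only its comparison with
    y^2 / 2 is needed. *)
Definition gap_denom b y : R := (expR b - 1) ^+ 2 - 2 * expR b * (cosh y - 1).

Lemma gap_denomE b y : gap_denom b y = (expR (b - y) - 1) * (expR (b + y) - 1).
Proof.
rewrite /gap_denom /cosh !expRD expRN; have := expR_gt0 y; set e := expR y => e0.
by field; rewrite gt_eqF.
Qed.

Lemma gap_denom_gt0 b y : 0 <= y -> y < b -> 0 < gap_denom b y.
Proof.
move=> y0 yb; rewrite gap_denomE mulr_gt0// subr_gt0 expR_gt1 ?subr_gt0//.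
by rewrite ltr_wpDr// (le_lt_trans y0).
Qed.

(** Subtracting the value -2 / (e^b - 1) at y = 0 leaves a constant times
    (cosh y - 1) / gap_denom, so that the cubic behaviour of the gap follows
    from bounds on cosh alone and no Taylor remainder of ln has to be
    estimated. *)
Lemma gap_slopeE b y : 0 <= y -> y < b ->
  - (expR (b - y) - 1)^-1 - (expR (b + y) - 1)^-1 =
  - (2 / (expR b - 1)) -
  2 * expR b * (expR b + 1) / (expR b - 1) * ((cosh y - 1) / gap_denom b y).
Proof.
move=> y0 yb; have := gap_denom_gt0 y0 yb; rewrite gap_denomE pmulr_lgt0; last first.
  by rewrite subr_gt0 expR_gt1 ltr_wpDr// (le_lt_trans y0).
move=> h1; have h2 : 0 < expR (b + y) - 1.
  by rewrite subr_gt0 expR_gt1 ltr_wpDr// (le_lt_trans y0).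
have h3 : 0 < expR b - 1 by rewrite subr_gt0 expR_gt1 (le_lt_trans y0).
move: h1 h2 h3; rewrite /cosh !expRD expRN.
have := expR_gt0 y; set e := expR y => e0; set E := expR b => h1 h2 h3.
have h4 : 0 < E + -1 * e by move: h1; rewrite subr_gt0 ltr_pdivlMr//; lra.
by field; rewrite !gt_eqF.
Qed.

(** The third derivative of lnq at b. *)
Definition lnq3 b : R := expR b * (expR b + 1) / (expR b - 1) ^+ 3.

Lemma log_gap0 b : log_gap b 0 = 0.
Proof. by rewrite /log_gap subr0 addr0 subrr. Qed.

Lemma lnq3_gt0 b : 0 < b -> 0 < lnq3 b.
Proof.
move=> b0; have h : 0 < expR b - 1 by rewrite subr_gt0 expR_gt1.
apply: divr_gt0; last exact: exprn_gt0.
by have := expR_gt0 b => e0; rewrite mulr_gt0// addr_gt0.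
Qed.

(** Replacing cosh x - 1 by x^2 / 2 and the denominator by its value at 0 can
    only raise the slope.  The bound holds up to the singularity y = b, hence
    for all coefficients and not only for those near the middle. *)
Lemma log_gap_le b y : 0 <= y -> y < b ->
  log_gap b y <= - (2 / (expR b - 1)) * y - lnq3 b * (y ^+ 3 / 3).
Proof.
move=> y0 yb.
have h : 0 < expR b - 1 by rewrite subr_gt0 expR_gt1 (le_lt_trans y0).
rewrite -subr_ge0; set f := fun y =>
  - (2 / (expR b - 1)) * y - lnq3 b * (y ^+ 3 / 3) - log_gap b y.
have f0 : f 0 = 0 by rewrite /f log_gap0 expr0n/= !(mul0r,mulr0,subr0).
rewrite -[leLHS]f0 -[leRHS]/(f y).
apply: (@derive_ge0_le f (fun x =>
  2 * expR b * (expR b + 1) / (expR b - 1) * ((cosh x - 1) / gap_denom b x)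
  - lnq3 b * x ^+ 2) y y0) => x /andP[x0 xy].
  have xb := le_lt_trans xy yb.
  have := is_derive_log_gap x0 xb; rewrite gap_slopeE// => ?.
  by apply: is_derive_eq; rewrite /GRing.scale/=; lra.
have xb := le_lt_trans xy yb.
rewrite subr_ge0.
have -> : lnq3 b * x ^+ 2 = 2 * expR b * (expR b + 1) / (expR b - 1) *
    ((x ^+ 2 / 2) / (expR b - 1) ^+ 2).
  by rewrite /lnq3; field; rewrite gt_eqF.
rewrite ler_wpM2l//.
  by rewrite divr_ge0 ?ltW// !mulr_gt0 ?addr_gt0 ?expR_gt0.
have c1 := cosh1_ge x0.
have x2 : 0 <= x ^+ 2 / 2 by rewrite divr_ge0// sqr_ge0.
apply: ler_pM => //; first by rewrite invr_ge0 sqr_ge0.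
rewrite lef_pV2 ?posrE ?gap_denom_gt0 ?exprn_gt0//.
by rewrite /gap_denom lerBlDr lerDl !mulr_ge0 ?expR_ge0// (le_trans x2).
Qed.

(** The factor by which, on [0, y], the correction to the slope can exceed its
    leading term; it tends to 1 as y tends to 0. *)
Definition gap_slack b y : R :=
  cosh (y / 2) ^+ 2 * ((expR b - 1) ^+ 2 / gap_denom b y).

(** The reverse comparison: on [0, y] the correction to the slope is at most
    gap_slack times its leading term. *)
Lemma log_gap_ge b y x : 0 <= x -> x <= y -> y < b ->
  - (2 / (expR b - 1)) * x - gap_slack b y * lnq3 b * (x ^+ 3 / 3) <= log_gap b x.
Proof.
move=> x0 xy yb; have y0 := le_trans x0 xy.
have h : 0 < expR b - 1 by rewrite subr_gt0 expR_gt1 (le_lt_trans y0).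
rewrite -subr_ge0.
set f := fun x => log_gap b x
  - (- (2 / (expR b - 1)) * x - gap_slack b y * lnq3 b * (x ^+ 3 / 3)).
have f0 : f 0 = 0 by rewrite /f log_gap0 expr0n/= !(mul0r,mulr0,subr0).
rewrite -[leLHS]f0 -[leRHS]/(f x).
apply: (@derive_ge0_le f (fun x => gap_slack b y * lnq3 b * x ^+ 2
  - 2 * expR b * (expR b + 1) / (expR b - 1) * ((cosh x - 1) / gap_denom b x))
  x x0) => s /andP[s0 sx].
  have sb := le_lt_trans (le_trans sx xy) yb.
  have := is_derive_log_gap s0 sb; rewrite gap_slopeE// => ?.
  by apply: is_derive_eq; rewrite /GRing.scale/=; lra.
have sy := le_trans sx xy; have sb := le_lt_trans sy yb.
have d0 := gap_denom_gt0 y0 yb.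
rewrite subr_ge0.
have -> : gap_slack b y * lnq3 b * s ^+ 2 =
    2 * expR b * (expR b + 1) / (expR b - 1) *
    ((s ^+ 2 / 2 * cosh (y / 2) ^+ 2) / gap_denom b y).
  by rewrite /lnq3 /gap_slack; field; rewrite !gt_eqF.
rewrite ler_wpM2l//.
  by rewrite divr_ge0 ?ltW// !mulr_gt0 ?addr_gt0 ?expR_gt0.
apply: ler_pM; rewrite ?invr_ge0 ?(ltW (gap_denom_gt0 s0 sb))//.
- by rewrite subr_ge0 cosh_ge1.
- exact: cosh1_le.
rewrite lef_pV2 ?posrE ?gap_denom_gt0//.
by rewrite /gap_denom lerB// ler_wpM2l ?mulr_ge0 ?expR_ge0// lerD2r cosh_le.
Qed.

End elementary.

(** * Ratios of (p,q)-binomial coefficients *)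

Section binomial_ratio.
Context {R : realType}.
Implicit Types (p q z gamma u : R) (n k l i : nat).

(** Consecutive coefficients have the ratio [n-k] / [k+1], where
    [m] = p^m - q^m.  The cross-multiplied form serves both for climbing from
    the middle and for descending from it. *)
Lemma pq_binomial_rec p q n k : 0 <= q < p -> (k < n)%N ->
  pq_binomial p q n k.+1 * (p ^+ k.+1 - q ^+ k.+1) =
  pq_binomial p q n k * (p ^+ (n - k) - q ^+ (n - k)).
Proof.
move=> /andP[q0 qp] kn.
have nz j : (0 < j)%N -> p ^+ j - q ^+ j != 0.
  by move=> j0; rewrite subr_eq0 gt_eqF// ltrXn2r// -lt0n.
rewrite /pq_binomial !big_split/= [X in _ * X * _ = _]big_nat_recr//=.
rewrite mulrA mulfVK ?nz//.
rewrite [RHS]mulrAC; congr (_ * _).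
rewrite big_nat_recl// mulrC (_ : n - k.+1 + 1 = n - k)%N; last by lia.
congr (_ * _); apply: eq_bigr => j _.
by rewrite (_ : n - k.+1 + j.+1 = n - k + j)%N//; lia.
Qed.

(** The middle of z i / n and z (n + 1 - i) / n for every i: centred here, and
    not at z / 2, the two positions entering a ratio of consecutive
    coefficients are symmetric. *)
Definition mid z n : R := z * (n%:R + 1) / (2 * n%:R).

(** The logarithm of C(n, n/2 + l) / C(n, n/2), as the sum of the logarithms
    of l consecutive ratios. *)
Definition log_ratio z gamma n l : R :=
  \sum_(i < l) ((2 * i%:R + 1) / n%:R * param_u z gamma n
                + log_gap (mid z n) (z * (2 * i%:R + 1) / (2 * n%:R))).

Lemma pq_bracketE z gamma n m : 0 < z -> (0 < n)%N -> (0 < m)%N ->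
  param_p z gamma n ^+ m - param_q z gamma n ^+ m =
  expR (lnq (z * m%:R / n%:R) - param_u z gamma n * m%:R / n%:R).
Proof.
move=> z0 n0 m0; have nR : 0 < n%:R :> R by rewrite ltr0n.
have mR : 0 < m%:R :> R by rewrite ltr0n.
rewrite /param_q /param_p /param_r exprMn -!expRM_natl expRD lnK; last first.
  by rewrite posrE subr_gt0 expR_lt1 oppr_lt0 divr_gt0// mulr_gt0.
have -> : m%:R * (- param_u z gamma n / n%:R) = - (param_u z gamma n * m%:R / n%:R).
  by field; rewrite gt_eqF.
have -> : m%:R * (- z / n%:R) = - (z * m%:R / n%:R) by field; rewrite gt_eqF.
by ring.
Qed.

Lemma pq_ratioE z gamma k i : 0 < z -> (i < k)%N ->
  expR ((2 * i%:R + 1) / k.*2%:R * param_u z gamma k.*2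
                + log_gap (mid z k.*2) (z * (2 * i%:R + 1) / (2 * k.*2%:R))) *
  (param_p z gamma k.*2 ^+ (k + i).+1 - param_q z gamma k.*2 ^+ (k + i).+1) =
  param_p z gamma k.*2 ^+ (k - i) - param_q z gamma k.*2 ^+ (k - i).
Proof.
move=> z0 ik; set n := k.*2; have k0 : (0 < k)%N by exact: leq_ltn_trans ik.
have kR : 0 < k%:R :> R by rewrite ltr0n.
have n0 : (0 < n)%N by rewrite double_gt0.
rewrite !pq_bracketE ?subn_gt0// -expRD; congr expR.
have nE : n%:R = 2 * k%:R :> R by rewrite -natrM mul2n.
rewrite /log_gap -[(k + i).+1%:R]natr1 natrD natrB 1?ltnW// /mid !nE.
have -> : z * (2 * k%:R + 1) / (2 * (2 * k%:R)) - z * (2 * i%:R + 1) / (2 * (2 * k%:R)) =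
   z * (k%:R - i%:R) / (2 * k%:R) by field; rewrite gt_eqF.
have -> : z * (2 * k%:R + 1) / (2 * (2 * k%:R)) + z * (2 * i%:R + 1) / (2 * (2 * k%:R)) =
   z * (k%:R + i%:R + 1) / (2 * k%:R) by field; rewrite gt_eqF.
by field; rewrite gt_eqF.
Qed.

Lemma param_q_lt z gamma n : 0 < z -> (0 < n)%N ->
  0 <= param_q z gamma n < param_p z gamma n.
Proof.
move=> z0 n0; rewrite /param_q mulr_ge0 ?expR_ge0//= gtr_pMr ?expR_gt0//.
by rewrite expR_lt1 mulNr oppr_lt0 divr_gt0 ?ltr0n.
Qed.

Lemma pqC_gt0 z gamma n k : 0 < z -> (0 < n)%N -> (k <= n)%N ->
  0 < pqC z gamma n k.
Proof.
move=> z0 n0 kn; have /andP[q0 qp] := param_q_lt gamma z0 n0.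
rewrite /pqC /pq_binomial big_nat; apply: prodr_gt0 => j /andP[j0 jk].
by rewrite divr_gt0// subr_gt0 ltrXn2r// -?lt0n// addn_gt0 j0 orbT.
Qed.

Lemma pqC_upE z gamma k l : 0 < z -> (l <= k)%N ->
  pqC z gamma k.*2 (k + l) =
  pqC z gamma k.*2 k * expR (log_ratio z gamma k.*2 l).
Proof.
move=> z0; elim: l => [_|l IH lk].
  by rewrite addn0 /log_ratio big_ord0 expR0 mulr1.
have k0 : (0 < k.*2)%N by rewrite double_gt0; exact: leq_ltn_trans lk.
have qp := param_q_lt gamma z0 k0.
have h : param_p z gamma k.*2 ^+ (k + l).+1 - param_q z gamma k.*2 ^+ (k + l).+1 != 0.
  by move/andP: qp => [q0 qp]; rewrite subr_eq0 gt_eqF// ltrXn2r.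
apply: (mulIf h); rewrite addnS /pqC pq_binomial_rec//; last by lia.
rewrite -/(pqC _ _ _ _) IH 1?ltnW// /log_ratio big_ord_recr/= expRD.
rewrite [in RHS]mulrA -[RHS]mulrA.
congr (_ * _); have -> : (k.*2 - (k + l) = k - l)%N by lia.
exact: (esym (pq_ratioE gamma z0 lk)).
Qed.

(** The step from k - l to k - l - 1 has the same ratio [k-l] / [k+l+1] as the
    step from k + l to k + l + 1, whence the symmetry of the coefficients. *)
Lemma pqC_downE z gamma k l : 0 < z -> (l <= k)%N ->
  pqC z gamma k.*2 (k - l) =
  pqC z gamma k.*2 k * expR (log_ratio z gamma k.*2 l).
Proof.
move=> z0; elim: l => [_|l IH lk].
  by rewrite subn0 /log_ratio big_ord0 expR0 mulr1.
have k0 : (0 < k.*2)%N by rewrite double_gt0; exact: leq_ltn_trans lk.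
have qp := param_q_lt gamma z0 k0.
have h : param_p z gamma k.*2 ^+ (k + l).+1 - param_q z gamma k.*2 ^+ (k + l).+1 != 0.
  by move/andP: qp => [q0 qp']; rewrite subr_eq0 gt_eqF// ltrXn2r.
apply: (mulIf h).
have kl : (k - l.+1 < k.*2)%N by lia.
have := pq_binomial_rec qp kl.
rewrite (_ : k.*2 - (k - l.+1) = (k + l).+1)%N; last by lia.
rewrite /pqC => <-; rewrite (_ : (k - l.+1).+1 = k - l)%N; last by lia.
rewrite -/(pqC _ _ _ _) IH 1?ltnW// /log_ratio big_ord_recr/= expRD.
rewrite [in RHS]mulrA -[RHS]mulrA.
congr (_ * _); exact: (esym (pq_ratioE gamma z0 lk)).
Qed.

Lemma sum_odd l : \sum_(i < l) (2 * i%:R + 1) = l%:R ^+ 2 :> R.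
Proof.
elim: l => [|l IH]; first by rewrite big_ord0 expr0n.
by rewrite big_ord_recr/= IH -natr1; ring.
Qed.

Lemma sum_odd_cube l :
  \sum_(i < l) (2 * i%:R + 1) ^+ 3 = 2 * l%:R ^+ 4 - l%:R ^+ 2 :> R.
Proof.
elim: l => [|l IH]; first by rewrite big_ord0 !expr0n/= mulr0 subrr.
by rewrite big_ord_recr/= IH -natr1; ring.
Qed.

Section bounds.
Variables (z gamma : R) (k l : nat).
Hypotheses (z0 : 0 < z) (k0 : (0 < k)%N) (lk : (l <= k)%N).
Let n := k.*2.
Let c := lnq3 (mid z n) * z ^+ 3 / (24 * n%:R ^+ 3) * (2 * l%:R ^+ 4 - l%:R ^+ 2).
Let s := l%:R ^+ 2 / n%:R * (param_u z gamma n - z / (expR (mid z n) - 1)).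

Let nR : 0 < n%:R :> R. Proof. by rewrite ltr0n double_gt0. Qed.

Let nE : n%:R = 2 * k%:R :> R. Proof. by rewrite -natrM mul2n. Qed.

Let midE1 : 0 < expR (mid z n) - 1.
Proof.
by rewrite subr_gt0 expR_gt1 /mid divr_gt0 ?mulr_gt0// ltr_wpDl.
Qed.

Let below i : (i < l)%N -> 0 <= z * (2 * i%:R + 1) / (2 * n%:R) <= z * l%:R / n%:R.
Proof.
move=> il; apply/andP; split.
  by apply: divr_ge0; rewrite ?mulr_ge0// ltW// ltr_wpDl.
have -> : z * l%:R / n%:R = z * (2 * l%:R) / (2 * n%:R) by field; rewrite gt_eqF.
rewrite ler_pM2r ?invr_gt0 ?mulr_gt0// ler_pM2l//.
by rewrite -natrM -natrM natr1 ler_nat; lia.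
Qed.

Lemma top_lt_mid : z * l%:R / n%:R < mid z n.
Proof.
have -> : z * l%:R / n%:R = z * (2 * l%:R) / (2 * n%:R) by field; rewrite gt_eqF.
rewrite /mid ltr_pM2r ?invr_gt0 ?mulr_gt0// ltr_pM2l//.
by rewrite -natrM natr1 ltr_nat /n; lia.
Qed.

Lemma log_ratio_le : log_ratio z gamma n l <= s - c.
Proof.
have -> : s - c = \sum_(i < l) ((2 * i%:R + 1) / n%:R * param_u z gamma n +
   (- (2 / (expR (mid z n) - 1)) * (z * (2 * i%:R + 1) / (2 * n%:R)) -
    lnq3 (mid z n) * ((z * (2 * i%:R + 1) / (2 * n%:R)) ^+ 3 / 3))).
  under eq_bigr => i _.
    rewrite (_ : _ + _ = (2 * i%:R + 1) *
        (1 / n%:R * (param_u z gamma n - z / (expR (mid z n) - 1))) -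
        (2 * i%:R + 1) ^+ 3 *
        (lnq3 (mid z n) * z ^+ 3 / (24 * n%:R ^+ 3))); last first.
      by field; rewrite !gt_eqF.
    over.
  rewrite sumrB -!mulr_suml sum_odd sum_odd_cube /s /c.
  by congr (_ - _); [rewrite mul1r mulrA|rewrite mulrC].
apply: ler_sum => i _; rewrite lerD2l.
have /andP[i0 il] := below (ltn_ord i).
by apply: log_gap_le => //; exact: le_lt_trans top_lt_mid.
Qed.

Lemma log_ratio_ge :
  s - gap_slack (mid z n) (z * l%:R / n%:R) * c <= log_ratio z gamma n l.
Proof.
set g := gap_slack _ _.
have -> : s - g * c = \sum_(i < l) ((2 * i%:R + 1) / n%:R * param_u z gamma n +
   (- (2 / (expR (mid z n) - 1)) * (z * (2 * i%:R + 1) / (2 * n%:R)) -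
    g * lnq3 (mid z n) * ((z * (2 * i%:R + 1) / (2 * n%:R)) ^+ 3 / 3))).
  under eq_bigr => i _.
    rewrite (_ : _ + _ = (2 * i%:R + 1) *
        (1 / n%:R * (param_u z gamma n - z / (expR (mid z n) - 1))) -
        (2 * i%:R + 1) ^+ 3 *
        (g * (lnq3 (mid z n) * z ^+ 3 / (24 * n%:R ^+ 3)))); last first.
      by field; rewrite !gt_eqF.
    over.
  rewrite sumrB -!mulr_suml sum_odd sum_odd_cube /s /c.
  by congr (_ - _); [rewrite mul1r mulrA|rewrite [RHS]mulrC -[RHS]mulrA].
apply: ler_sum => i _; rewrite lerD2l.
have /andP[i0 il] := below (ltn_ord i).
by apply: log_gap_ge => //; exact: top_lt_mid.
Qed.

End bounds.

End binomial_ratio.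

(** * The bounds at the scale n^(3/4) *)

Section asymptotics.
Context {R : realType}.
Variables (z gamma : R).
Hypothesis z0 : 0 < z.
Implicit Types (k l : nat).

(** This is the value of u for which the linear part of the gap, centred at
    z / 2, is cancelled exactly. *)
Lemma coefA_half : coefA z / 2 = z / (expR (z / 2) - 1).
Proof.
have e0 := expR_gt0 (z / 4); have e1 : 1 < expR (z / 4) by rewrite expR_gt1 divr_gt0.
rewrite /coefA /coth /cosh /sinh expRN.
have -> : expR (z / 2) = expR (z / 4) ^+ 2 by rewrite -expRM_natl; congr expR; field.
move: e0 e1; set e := expR _ => e0 e1; field.
have ? : 0 < e ^+ 2 - 1 by rewrite subr_gt0 exprn_egt1.
by rewrite !gt_eqF//=; lra.
Qed.

Lemma coefBE : Defs.coefB z = z ^+ 3 * lnq3 (z / 2).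
Proof.
have e0 := expR_gt0 (z / 4); have e1 : 1 < expR (z / 4) by rewrite expR_gt1 divr_gt0.
rewrite /Defs.coefB /lnq3 /sinh !expRN.
have -> : expR (z / 2) = expR (z / 4) ^+ 2 by rewrite -expRM_natl; congr expR; field.
move: e0 e1; set e := expR _ => e0 e1; field.
have ? : 0 < e ^+ 2 - 1 by rewrite subr_gt0 exprn_egt1.
by rewrite !gt_eqF//=; lra.
Qed.

Lemma mid_itv n : (0 < n)%N -> z / 2 <= mid z n <= z.
Proof.
move=> n0; have nR : 1 <= n%:R :> R by rewrite ler1n.
have -> : mid z n = z / 2 + z / (2 * n%:R) by rewrite /mid; field; rewrite gt_eqF//; lra.
have h : 0 <= z / (2 * n%:R) <= z / 2.
  rewrite divr_ge0 ?(ltW z0)//= ler_pM2l// lef_pV2 ?posrE//; lra.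
by lra.
Qed.

(** The gap is centred at mid z n while u is tuned to z / 2; the resulting
    change of the first order coefficient is at most drift_bound / n. *)
Definition drift_bound : R := z ^+ 2 * expR z / (2 * (expR (z / 2) - 1) ^+ 2).

Lemma drift_itv n : (0 < n)%N ->
  0 <= z / (expR (z / 2) - 1) - z / (expR (mid z n) - 1) <= drift_bound / n%:R.
Proof.
move=> n0; have nR : 0 < n%:R :> R by rewrite ltr0n.
have /andP[m1 m2] := mid_itv n0.
have h1 : 0 < expR (z / 2) - 1 by rewrite subr_gt0 expR_gt1 divr_gt0.
have h2 : expR (z / 2) - 1 <= expR (mid z n) - 1 by rewrite lerD2r ler_expR.
have h3 := lt_le_trans h1 h2.
apply/andP; split; first by rewrite subr_ge0 ler_pM2l// lef_pV2.
have -> : z / (expR (z / 2) - 1) - z / (expR (mid z n) - 1) =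
  z * (expR (mid z n) - expR (z / 2)) / ((expR (z / 2) - 1) * (expR (mid z n) - 1)).
  by field; rewrite !gt_eqF.
have h4 : expR (mid z n) - expR (z / 2) <= z / (2 * n%:R) * expR z.
  have e : mid z n = z / 2 + z / (2 * n%:R) by rewrite /mid; field; rewrite gt_eqF.
  have : expR (mid z n) * (1 - z / (2 * n%:R)) <= expR (z / 2).
    have -> : expR (z / 2) = expR (mid z n) * expR (- (z / (2 * n%:R))).
      by rewrite -expRD e addrK.
    by rewrite ler_pM2l ?expR_gt0// expR_ge1Dx.
  have : z / (2 * n%:R) * expR (mid z n) <= z / (2 * n%:R) * expR z.
    by rewrite ler_pM2l ?ler_expR// divr_gt0// mulr_gt0.
  by lra.
rewrite ler_pdivrMr ?mulr_gt0//.
apply: (@le_trans _ _ (z * (z / (2 * n%:R) * expR z))); first by rewrite ler_pM2l.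
have -> : drift_bound / n%:R * ((expR (z / 2) - 1) * (expR (mid z n) - 1)) =
  z * (z / (2 * n%:R) * expR z) * ((expR (mid z n) - 1) / (expR (z / 2) - 1)).
  by rewrite /drift_bound; field; rewrite !gt_eqF.
rewrite ler_peMr ?ler_pdivlMr ?mul1r//.
by rewrite !mulr_ge0 ?expR_ge0 ?ltW// invr_gt0 mulr_gt0.
Qed.

Lemma lnq3_mid_itv n : (0 < n)%N ->
  (expR z - 1)^-1 <= lnq3 (mid z n) <= expR z * (expR z + 1) / (expR (z / 2) - 1) ^+ 3.
Proof.
move=> n0; have /andP[m1 m2] := mid_itv n0.
have h1 : 0 < expR (z / 2) - 1 by rewrite subr_gt0 expR_gt1 divr_gt0.
have h2 : expR (z / 2) - 1 <= expR (mid z n) - 1 by rewrite lerD2r ler_expR.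
have h3 := lt_le_trans h1 h2.
have h4 : expR (mid z n) <= expR z by rewrite ler_expR.
have h5 := expR_gt0 (mid z n).
apply/andP; split; last first.
  apply: ler_pM.
  - by rewrite mulr_ge0// ltW// addr_gt0.
  - by rewrite invr_ge0 exprn_ge0// ltW.
  - by apply: ler_pM; rewrite ?lerD2r ?(ltW h5)// ltW// addr_gt0.
  - by rewrite lef_pV2 ?posrE ?exprn_gt0// lerXn2r ?nnegrE// ltW.
apply: (@le_trans _ _ (expR (mid z n) - 1)^-1).
  by rewrite lef_pV2 ?posrE//; lra.
rewrite /lnq3 ler_pdivlMr ?exprn_gt0// mulrC exprSr mulfK ?gt_eqF//.
by rewrite expr2; nra.
Qed.

(** The scale of the fluctuations of l: l^2 / n^(3/2) and l^4 / n^3 are the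
    powers of l / n^(3/4) that survive in the limit. *)
Definition fluct n : R := n%:R `^ (3 / 4).

Lemma fluct_gt0 n : (0 < n)%N -> 0 < fluct n.
Proof. by move=> n0; apply: powR_gt0; rewrite ltr0n. Qed.

(** All powers of n below are expressed through s = sqrt n, with n = s^2 and
    n^(3/2) = s^3, so that they can be compared by ring identities. *)
Lemma fluct_sqr n : fluct n ^+ 2 = Num.sqrt n%:R ^+ 3.
Proof.
rewrite /fluct -powR_mulrn ?powR_ge0// -powRrM.
rewrite -powR_mulrn ?sqrtr_ge0// -powR12_sqrt// -powRrM.
by congr (_ `^ _); field.
Qed.

Lemma sqrt_inv_sqrt n : (0 < n)%N ->
  Num.sqrt (Num.sqrt n%:R)^-1 = fluct n / n%:R :> R.
Proof.
move=> n0; have s0 : 0 < Num.sqrt n%:R :> R by rewrite sqrtr_gt0 ltr0n.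
have -> : (Num.sqrt n%:R)^-1 = (fluct n / n%:R) ^+ 2 :> R.
  rewrite expr_div_n fluct_sqr -[X in _ / X ^+ 2](@sqr_sqrtr _ n%:R)//.
  by field; rewrite gt_eqF.
by rewrite sqrtr_sqr ger0_norm// divr_ge0 ?ler0n ?powR_ge0.
Qed.

Section one_size.
Variables (k l : nat).
Hypotheses (k0 : (0 < k)%N) (lk : (l <= k)%N).
Let n := k.*2.
Let t : R := l%:R / fluct n.
Let s : R := Num.sqrt n%:R.

Let n0 : (0 < n)%N. Proof. by rewrite double_gt0. Qed.
Let s0 : 0 < s. Proof. by rewrite sqrtr_gt0 ltr0n. Qed.
Let nE : n%:R = s ^+ 2 :> R. Proof. by rewrite sqr_sqrtr// ler0n. Qed.
Let l2E : l%:R ^+ 2 = t ^+ 2 * s ^+ 3.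
Proof. by rewrite /s -fluct_sqr /t; field; rewrite gt_eqF// fluct_gt0. Qed.
Let l4E : l%:R ^+ 4 = t ^+ 4 * s ^+ 6.
Proof.
have -> : l%:R ^+ 4 = (l%:R ^+ 2) ^+ 2 :> R by ring.
by rewrite l2E; ring.
Qed.

Lemma log_ratio_le_scaled :
  log_ratio z gamma n l <= gamma * t ^+ 2 + drift_bound * (t ^+ 2 / s)
    - lnq3 (mid z n) * z ^+ 3 / 12 * (t ^+ 4 - t ^+ 2 / (2 * s ^+ 3)).
Proof.
apply: (le_trans (log_ratio_le gamma z0 k0 lk)).
rewrite -/n /param_u coefA_half -/s.
have /andP[_ d] := drift_itv n0.
have -> : gamma * t ^+ 2 + drift_bound * (t ^+ 2 / s) =
    l%:R ^+ 2 / n%:R * (gamma / s + drift_bound / n%:R).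
  by rewrite nE l2E; field; rewrite gt_eqF.
rewrite lerB//; last first.
  rewrite nE l2E l4E le_eqVlt; apply/orP; left; apply/eqP; field.
  by rewrite gt_eqF.
rewrite ler_wpM2l ?divr_ge0 ?sqr_ge0 ?ler0n//.
rewrite -lerBlDl; apply: le_trans d.
by rewrite le_eqVlt; apply/orP; left; apply/eqP; ring.
Qed.

Lemma log_ratio_ge_scaled :
  gamma * t ^+ 2 - gap_slack (mid z n) (z * (t * Num.sqrt s^-1))
     * (lnq3 (mid z n) * z ^+ 3 / 12) * t ^+ 4 <= log_ratio z gamma n l.
Proof.
apply: (le_trans _ (log_ratio_ge gamma z0 k0 lk)).
rewrite -/n /param_u coefA_half -/s.
have /andP[d _] := drift_itv n0.
have yE : z * l%:R / n%:R = z * (t * Num.sqrt s^-1).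
  rewrite sqrt_inv_sqrt//.
  by rewrite /t; field; rewrite ?gt_eqF ?fluct_gt0// ltr0n.
have /andP[m1 m2] := mid_itv n0.
rewrite yE; set y := z * (t * _) in yE *; set g := gap_slack _ _.
have -> : gamma * t ^+ 2 = l%:R ^+ 2 / n%:R * (gamma / s).
  by rewrite nE l2E; field; rewrite gt_eqF.
rewrite lerB//.
  rewrite ler_wpM2l ?divr_ge0 ?sqr_ge0 ?ler0n//.
  by rewrite addrAC lerDr.
have yb : 0 <= gap_denom (mid z n) y.
  rewrite -yE; apply/ltW/gap_denom_gt0; last exact: top_lt_mid.
  by rewrite mulr_ge0 ?invr_ge0 ?ler0n// mulr_ge0 ?ler0n// ltW.
have g0 : 0 <= g by rewrite /g /gap_slack mulr_ge0 ?sqr_ge0// divr_ge0 ?sqr_ge0.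
rewrite -[leRHS]mulrA ler_wpM2l//.
have b0 : 0 <= lnq3 (mid z n) * z ^+ 3 / 12.
  rewrite divr_ge0// mulr_ge0 ?exprn_ge0// ?ltW// lnq3_gt0//.
  by rewrite (lt_le_trans _ m1)// divr_gt0.
have -> : lnq3 (mid z n) * z ^+ 3 / (24 * n%:R ^+ 3) * (2 * l%:R ^+ 4 - l%:R ^+ 2) =
  lnq3 (mid z n) * z ^+ 3 / 12 * (t ^+ 4 - t ^+ 2 / (2 * s ^+ 3)).
  by rewrite nE l2E l4E; field; rewrite gt_eqF.
rewrite ler_wpM2l// lerBlDr lerDl divr_ge0 ?sqr_ge0// mulr_ge0// exprn_ge0//.
exact: ltW.
Qed.

End one_size.

End asymptotics.

(** * Pointwise limit and domination of the log-ratio *)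

Section limits.
Context {R : realType}.
Variables (z gamma : R).
Hypothesis z0 : 0 < z.
Implicit Types (k l : nat).

Lemma cvg_expR (f : nat -> R) (a : R) :
  f k @[k --> \oo] --> a -> expR (f k) @[k --> \oo] --> expR a.
Proof. by move=> fa; apply: continuous_cvg fa; exact: continuous_expR. Qed.

Lemma cvg_sqrt (f : nat -> R) (a : R) :
  f k @[k --> \oo] --> a -> Num.sqrt (f k) @[k --> \oo] --> Num.sqrt a.
Proof. by move=> fa; apply: continuous_cvg fa; exact: sqrt_continuous. Qed.

Lemma cvg_exprn (m : nat) (f : nat -> R) (a : R) :
  f k @[k --> \oo] --> a -> f k ^+ m @[k --> \oo] --> a ^+ m.
Proof. move=> fa; apply: (@continuous_cvg _ _ _ _ _ f (fun x : R => x ^+ m)) => //.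
exact: exprn_continuous. Qed.

Lemma cosh0 : cosh 0 = 1 :> R.
Proof. by rewrite /cosh oppr0 expR0; lra. Qed.

Lemma cvg_cosh (y : nat -> R) (a : R) :
  y k @[k --> \oo] --> a -> cosh (y k) @[k --> \oo] --> cosh a.
Proof.
move=> ya.
exact: (cvgM (cvgD (cvg_expR ya) (cvg_expR (cvgN ya))) (cvg_cst _)).
Qed.

Lemma cvg_gap_slack (b y : nat -> R) (b1 : R) : 0 < b1 ->
  b k @[k --> \oo] --> b1 -> y k @[k --> \oo] --> (0 : R) ->
  gap_slack (b k) (y k) @[k --> \oo] --> (1 : R).
Proof.
move=> b10 bb yy.
have eb := cvg_expR bb.
have h : 0 < expR b1 - 1 by rewrite subr_gt0 expR_gt1.
have eb1 : (expR (b k) - 1) ^+ 2 @[k --> \oo] --> (expR b1 - 1) ^+ 2.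
  have e1 : expR (b k) - 1 @[k --> \oo] --> expR b1 - 1.
    exact: (cvgB eb (cvg_cst _)).
  exact: cvg_exprn e1.
have cy : cosh (y k) - 1 @[k --> \oo] --> (0 : R).
  rewrite -(subrr 1) -[X in _ --> X - _]cosh0.
  exact: (cvgB (cvg_cosh yy) (cvg_cst _)).
have cd : gap_denom (b k) (y k) @[k --> \oo] --> (expR b1 - 1) ^+ 2.
  rewrite -[X in _ --> X]subr0 -(mulr0 (2 * expR b1)).
  exact: (cvgB eb1 (cvgM (cvgM (cvg_cst _) eb) cy)).
have ch : cosh (y k / 2) @[k --> \oo] --> (1 : R).
  rewrite -[X in _ --> X]cosh0; apply: cvg_cosh.
  by rewrite -(mul0r 2^-1); exact: (cvgM yy (cvg_cst _)).
have -> : 1 = 1 ^+ 2 * ((expR b1 - 1) ^+ 2 / (expR b1 - 1) ^+ 2) :> R.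
  by field; rewrite gt_eqF.
apply: cvgM; first exact: cvg_exprn ch.
by apply: (cvgM eb1 (cvgV _ cd)); rewrite gt_eqF// exprn_gt0.
Qed.

Lemma cvg_inv_sqrt : (Num.sqrt (k.*2)%:R)^-1 @[k --> \oo] --> (0 : R).
Proof.
have h : ((k.*2)%:R : R)^-1 @[k --> \oo] --> (0 : R).
  apply/gtr0_cvgV0.
    by exists 1%N => // k /= k0; rewrite ltr0n double_gt0.
  apply/cvgryPge => A; near=> k.
  rewrite (@le_trans _ _ k%:R)//; last by rewrite ler_nat -addnn leq_addr.
  by near: k; exact: nbhs_infty_ger.
have -> : (fun k => (Num.sqrt (k.*2)%:R)^-1) = (fun k => Num.sqrt ((k.*2)%:R : R)^-1).
  by apply/funext => k; rewrite sqrtrV.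
rewrite -(@sqrtr0 R).
exact: (cvg_sqrt h).
Unshelve. all: by end_near. Qed.

Lemma cvg_mid : mid z k.*2 @[k --> \oo] --> z / 2.
Proof.
set Z := z / 2; have h : Z + Z * ((Num.sqrt (k.*2)%:R)^-1 ^+ 2) @[k --> \oo] --> Z.
  have E : Z + Z * 0 ^+ 2 = Z by rewrite expr0n/= mulr0 addr0.
  rewrite -[X in _ --> X]E.
  exact: (cvgD (cvg_cst _) (cvgM (cvg_cst _) (cvg_exprn cvg_inv_sqrt))).
apply: cvg_trans h; apply: near_eq_cvg.
exists 1%N => // k /= k0; rewrite exprVn sqr_sqrtr//.
by rewrite /Z /mid; field; rewrite gt_eqF// ltr0n double_gt0.
Qed.

Lemma cvg_lnq3_mid : lnq3 (mid z k.*2) @[k --> \oo] --> lnq3 (z / 2).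
Proof.
have eb := cvg_expR cvg_mid.
have h : 0 < expR (z / 2) - 1 by rewrite subr_gt0 expR_gt1 divr_gt0.
have e1 : expR (mid z k.*2) - 1 @[k --> \oo] --> expR (z / 2) - 1.
  exact: (cvgB eb (cvg_cst _)).
apply: cvgM; first exact: (cvgM eb (cvgD eb (cvg_cst _))).
apply: cvgV; first by rewrite gt_eqF// exprn_gt0.
exact: cvg_exprn e1.
Qed.

(** With t = l / n^(3/4), the lower bound of log_ratio_ge_scaled involves the
    slack of the gap on [0, z l / n], and z l / n = z t n^(-1/4) tends to 0: the
    slack tends to 1 and the two bounds have the same limit. *)
Lemma cvg_log_ratio (l : nat -> nat) (tau : R) :
  (\forall k \near \oo, (l k <= k)%N) ->
  (l k)%:R / fluct k.*2 @[k --> \oo] --> tau ->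
  log_ratio z gamma k.*2 (l k) @[k --> \oo] --> quartic z gamma tau.
Proof.
move=> lk; set t := (fun k => (l k)%:R / fluct k.*2) => tt.
pose r k : R := (Num.sqrt (k.*2)%:R)^-1.
have r0 : r k @[k --> \oo] --> (0 : R) := cvg_inv_sqrt.
have t2 : t k ^+ 2 @[k --> \oo] --> tau ^+ 2 := cvg_exprn tt.
have t4 : t k ^+ 4 @[k --> \oo] --> tau ^+ 4 := cvg_exprn tt.
have b3 : lnq3 (mid z k.*2) * z ^+ 3 / 12 @[k --> \oo] --> lnq3 (z / 2) * z ^+ 3 / 12.
  exact: (cvgM (cvgM cvg_lnq3_mid (cvg_cst _)) (cvg_cst _)).
have g2 : gamma * t k ^+ 2 @[k --> \oo] --> gamma * tau ^+ 2.
  exact: (cvgM (cvg_cst _) t2).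
apply: (@squeeze_cvgr _ _ _ _
  (fun k => gamma * t k ^+ 2 - gap_slack (mid z k.*2) (z * (t k * Num.sqrt (r k)))
     * (lnq3 (mid z k.*2) * z ^+ 3 / 12) * t k ^+ 4)
  (fun k => gamma * t k ^+ 2 + drift_bound z * (t k ^+ 2 * r k)
    - lnq3 (mid z k.*2) * z ^+ 3 / 12 * (t k ^+ 4 - t k ^+ 2 / 2 * r k ^+ 3))).
- near=> k; have k0 : (0 < k)%N by near: k; exists 1%N.
  have lkk : (l k <= k)%N by near: k.
  rewrite (log_ratio_ge_scaled gamma z0 k0 lkk)/=.
  apply: (le_trans (log_ratio_le_scaled gamma z0 k0 lkk)).
  rewrite le_eqVlt; apply/orP; left; apply/eqP.
  by rewrite /t /r; field; rewrite ?gt_eqF ?fluct_gt0 ?sqrtr_gt0 ?ltr0n ?double_gt0.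
- rewrite /quartic coefBE//.
  have -> : gamma * tau ^+ 2 - z ^+ 3 * lnq3 (z / 2) / 12 * tau ^+ 4 =
    gamma * tau ^+ 2 - 1 * (lnq3 (z / 2) * z ^+ 3 / 12) * tau ^+ 4 by ring.
  have r2 : z * (t k * Num.sqrt (r k)) @[k --> \oo] --> z * (tau * Num.sqrt 0).
    exact: (cvgM (cvg_cst _) (cvgM tt (cvg_sqrt r0))).
  rewrite sqrtr0 !mulr0 in r2.
  have gs := cvg_gap_slack (divr_gt0 z0 (ltr0Sn R 1)) cvg_mid r2.
  exact: (cvgB g2 (cvgM (cvgM gs b3) t4)).
- rewrite /quartic coefBE//.
  have -> : gamma * tau ^+ 2 - z ^+ 3 * lnq3 (z / 2) / 12 * tau ^+ 4 =
    gamma * tau ^+ 2 + drift_bound z * (tau ^+ 2 * 0) - lnq3 (z / 2) * z ^+ 3 / 12 *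
    (tau ^+ 4 - tau ^+ 2 / 2 * 0 ^+ 3) by ring.
  apply: (cvgB (cvgD g2 (cvgM (cvg_cst _) (cvgM t2 r0))) (cvgM b3 (cvgB t4 _))).
  exact: (cvgM (cvgM t2 (cvg_cst _)) (cvg_exprn r0)).
Unshelve. all: by end_near. Qed.

(** The quartic term absorbs any quadratic and linear term.  The form C - 2 t^2
    leaves a Gaussian even after t is replaced by a point at distance 1 from
    it. *)
Lemma log_ratio_dominated (M : R) : 0 <= M -> exists C : R, forall k l,
  (0 < k)%N -> (l <= k)%N -> let t := l%:R / fluct k.*2 in
  log_ratio z gamma k.*2 l + M * t <= C - 2 * t ^+ 2.
Proof.
move=> M0.
pose bmin := (expR z - 1)^-1 * z ^+ 3 / 12.
pose bmax := expR z * (expR z + 1) / (expR (z / 2) - 1) ^+ 3 * z ^+ 3 / 12.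
have bmin0 : 0 < bmin.
  by rewrite /bmin divr_gt0// mulr_gt0 ?exprn_gt0// invr_gt0 subr_gt0 expR_gt1.
have db0 : 0 <= drift_bound z.
  by apply: divr_ge0; apply: mulr_ge0; rewrite ?sqr_ge0 ?expR_ge0.
(* With M t <= M (1 + t^2), what remains is the maximum over v = t^2 of
   (gamma + 2 + M) v - bmin v^2. *)
exists (drift_bound z + bmax / 2 + M + (gamma + 2 + M) ^+ 2 / (4 * bmin)) => k l k0 lk.
rewrite /=; set t := _ / _.
have := log_ratio_le_scaled gamma z0 k0 lk; rewrite -/t.
set s := Num.sqrt _.
have n0 : (0 < k.*2)%N by rewrite double_gt0.
have s1 : 1 <= s.
  by rewrite -(@sqrtr1 R) ler_wsqrtr// ler1n.
have s0 : 0 < s by rewrite (lt_le_trans _ s1).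
have /andP[b1 b2] := lnq3_mid_itv z0 n0.
set b := lnq3 _ * _ / _ => hle.
have bb : bmin <= b <= bmax.
  by rewrite /bmin /b /bmax !ler_pM2r ?exprn_gt0//; apply/andP.
have t1 : 0 <= t ^+ 2 / s <= 1.
  rewrite divr_ge0 ?sqr_ge0 ?(ltW s0)//=.
  have -> : t ^+ 2 / s = (l%:R / (k.*2)%:R) ^+ 2.
    rewrite /t !expr_div_n fluct_sqr -/s.
    rewrite -[X in _ = _ / X ^+ 2](@sqr_sqrtr _ (k.*2)%:R)// -/s.
    by field; rewrite gt_eqF.
  rewrite expr_le1// ?divr_ge0// ler_pdivrMr ?ltr0n// mul1r ler_nat.
  by rewrite (leq_trans lk)// -addnn leq_addr.
have t3 : 0 <= t ^+ 2 / (2 * s ^+ 3) <= 1 / 2.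
  rewrite divr_ge0 ?sqr_ge0 ?mulr_ge0 ?exprn_ge0 ?(ltW s0)//=.
  have -> : t ^+ 2 / (2 * s ^+ 3) = (t ^+ 2 / s) / (2 * s ^+ 2) by field; rewrite gt_eqF.
  case/andP: t1 => t10 t11.
  apply: ler_pM => //; first by rewrite invr_ge0 mulr_ge0 ?sqr_ge0.
  rewrite lef_pV2 ?posrE ?mulr_gt0 ?exprn_gt0//.
  by rewrite ler_peMr// exprn_ege1.
have t0 : 0 <= t by rewrite divr_ge0 ?powR_ge0.
have Mt : M * t <= M * (1 + t ^+ 2).
  by rewrite ler_wpM2l//; have := sqr_ge0 (t - 1); nra.
have hq : (gamma + 2 + M) * t ^+ 2 - bmin * t ^+ 4 <= (gamma + 2 + M) ^+ 2 / (4 * bmin).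
  rewrite ler_pdivlMr; last by rewrite mulr_gt0.
  have := sqr_ge0 (gamma + 2 + M - 2 * bmin * t ^+ 2).
  rewrite -subr_ge0 => h; rewrite -subr_ge0; apply: le_trans h _.
  by rewrite le_eqVlt; apply/orP; left; apply/eqP; ring.
have /andP[bb1 bb2] := bb.
have b0 : 0 <= b by rewrite (le_trans _ bb1)// ltW.
have x1 : drift_bound z * (t ^+ 2 / s) <= drift_bound z.
  by rewrite ler_piMr//; case/andP: t1.
have x2 : b * (t ^+ 2 / (2 * s ^+ 3)) <= bmax / 2.
  case/andP: t3 => t30 t31; apply: le_trans (_ : b * (1 / 2) <= _).
    by rewrite ler_wpM2l.
  by rewrite mul1r ler_pM2r.
have x3 : bmin * t ^+ 4 <= b * t ^+ 4.
  by rewrite ler_wpM2r// exprn_ge0.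
rewrite mulrBr in hle; rewrite mulrDr mulr1 in Mt; rewrite 2!mulrDl in hq.
have {}hle : log_ratio z gamma k.*2 l <=
    gamma * t ^+ 2 + drift_bound z - (bmin * t ^+ 4 - bmax / 2).
  apply: (le_trans hle); apply: lerB; first by rewrite lerD2l; exact: x1.
  by apply: lerB; [exact: x3|exact: x2].
move: hle Mt hq; clear.
generalize ((gamma + 2 + M) ^+ 2 / (4 * bmin)) (bmin * t ^+ 4) (M * t ^+ 2)
  (gamma * t ^+ 2) (M * t) (t ^+ 2) (drift_bound z) bmax.
by move=> *; lra.
Qed.

End limits.

(** * Sums over atoms as integrals of step functions *)

Section simple_sums.
Context d (T : measurableType d) (R : realType).
Variables (mu : {measure set T -> \bar R}) (N : nat).
Variables (v : nat -> R) (A : nat -> set T).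
Hypothesis mA : forall j, measurable (A j).
Hypothesis fA : forall j, (mu (A j) < +oo)%E.

Definition simple_sum (x : T) : R := \sum_(j < N) v j * \1_(A j) x.

Lemma measurable_simple_sum : measurable_fun [set: T] simple_sum.
Proof.
apply: measurable_sum => j; apply: measurable_funM => //.
Qed.

Let integrable_term j :
  mu.-integrable [set: T] (fun x => (v j * \1_(A j) x)%:E).
Proof.
apply: (@integrableZl _ _ _ mu setT measurableT (v j) (fun x => (\1_(A j) x)%:E)).
apply/integrableP; split; first exact/measurable_EFinP/measurable_indic.
under eq_integral do rewrite gee0_abs ?lee_fin//.
by rewrite integral_indic// setIT.
Qed.

Lemma integrable_simple_sum : mu.-integrable [set: T] (EFin \o simple_sum).
Proof.
rewrite /comp /simple_sum; under eq_fun do rewrite -sumEFin.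
by apply: integrable_sum => // j _; exact: integrable_term.
Qed.

Lemma Rintegral_simple_sum :
  \int[mu]_x simple_sum x = \sum_(j < N) v j * fine (mu (A j)).
Proof.
rewrite /Rintegral /simple_sum; under eq_integral do rewrite -sumEFin.
rewrite (integral_sum _ (fun j : 'I_N => integrable_term j))//.
rewrite (eq_bigr (fun j : 'I_N => (v j * fine (mu (A j)))%:E)) ?sumEFin//.
move=> j _; under eq_integral do rewrite EFinM.
rewrite integralZl//; last first.
  apply/integrableP; split; first exact/measurable_EFinP/measurable_indic.
  under eq_integral do rewrite gee0_abs ?lee_fin//.
  by rewrite integral_indic// setIT.
by rewrite integral_indic// setIT -[X in (_ * X)%E]fineK ?EFinM// ge0_fin_numE.
Qed.

Lemma simple_sum_in j x : (forall i, i != j -> ~ A i x) -> (j < N)%N -> A j x ->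
  simple_sum x = v j.
Proof.
move=> dA jN Aj; rewrite /simple_sum (bigD1 (Ordinal jN))//= indicE mem_set//.
rewrite mulr1 big1 ?addr0// => i ij; rewrite indicE memNset ?mulr0//.
apply: dA; apply: contra ij => /eqP ij; exact/eqP/val_inj.
Qed.

Lemma simple_sum_out x : (forall j, (j < N)%N -> ~ A j x) -> simple_sum x = 0.
Proof.
move=> dA; rewrite /simple_sum big1// => i _.
by rewrite indicE memNset ?mulr0//; exact: dA.
Qed.

End simple_sums.

Section step_functions.
Context {R : realType}.
Variables (z gamma : R).
Hypothesis z0 : 0 < z.
Implicit Types (k j : nat) (x : R).

Definition atom k j : R := (j%:R - k%:R) / fluct k.*2.
Definition mesh k : R := (fluct k.*2)^-1.
(** Each atom is spread uniformly over the cell to its right, which has the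
    length of the spacing of the atoms; sums over atoms become Lebesgue
    integrals. *)
Definition cell k j : set R := [set` `[atom k j, atom k j + mesh k[].
Definition dist_mid k j : nat := ((j - k) + (k - j))%N.
Definition relweight k j : R := expR (log_ratio z gamma k.*2 (dist_mid k j)).
Definition step k (v : nat -> R) (x : R) : R := simple_sum k.*2.+1 v (cell k) x.

Lemma mesh_gt0 k : (0 < k)%N -> 0 < mesh k.
Proof. by move=> k0; rewrite invr_gt0 fluct_gt0// double_gt0. Qed.

Lemma mesh_ge0 k : 0 <= mesh k.
Proof. by rewrite invr_ge0 powR_ge0. Qed.

Lemma mesh_le1 k : (0 < k)%N -> mesh k <= 1.
Proof.
move=> k0; rewrite /mesh invf_le1 ?fluct_gt0 ?double_gt0//.
by rewrite /fluct -[leLHS](powRr0 k.*2%:R) ler_powR// ?ler1n ?double_gt0.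
Qed.

Lemma measurable_cell k j : measurable (cell k j).
Proof. exact: measurable_itv. Qed.

Lemma measure_cell k j : lebesgue_measure (cell k j) = (mesh k)%:E.
Proof.
rewrite /cell lebesgue_measure_itv/= lte_fin ltrDl.
case: ltP => [_|m0]; first by rewrite -EFinD addrAC subrr add0r.
by congr EFin; apply/eqP; rewrite eq_le m0 mesh_ge0.
Qed.

Lemma measurable_step k v : measurable_fun [set: R] (step k v).
Proof. by apply: measurable_simple_sum => j; exact: measurable_cell. Qed.

Lemma integrable_step k v :
  lebesgue_measure.-integrable [set: R] (EFin \o step k v).
Proof.
apply: integrable_simple_sum => j; first exact: measurable_cell.
by have := measure_cell k j => /= ->; rewrite ltry.
Qed.

Lemma Rintegral_step k v :
  \int[lebesgue_measure]_x step k v x = \sum_(j < k.*2.+1) v j * mesh k.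
Proof.
rewrite /step Rintegral_simple_sum => [|j|j].
- by apply: eq_bigr => j _; have /= -> := measure_cell k j.
- exact: measurable_cell.
- by have /= -> := measure_cell k j; rewrite ltry.
Qed.

Lemma cellE k j x : (0 < k)%N ->
  cell k j x <-> j%:R <= x * fluct k.*2 + k%:R < j.+1%:R.
Proof.
move=> k0; have s0 : 0 < fluct k.*2 :> R by rewrite fluct_gt0// double_gt0.
rewrite /cell /atom /mesh /= in_itv/=.
have -> : (j%:R - k%:R) / fluct k.*2 + (fluct k.*2)^-1 =
    (j.+1%:R - k%:R) / fluct k.*2 :> R by rewrite -natr1; field; rewrite gt_eqF.
by rewrite ler_pdivrMr// ltr_pdivlMr// lerBlDr ltrBrDr.
Qed.

Lemma cell_inj k i j x : (0 < k)%N -> cell k i x -> cell k j x -> i = j.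
Proof.
move=> k0 /(cellE _ _ k0)/truncn_def <- /(cellE _ _ k0)/truncn_def <- //.
Qed.

Lemma step_in k v j x : (0 < k)%N -> (j <= k.*2)%N -> cell k j x ->
  step k v x = v j.
Proof.
move=> k0 jk cj; apply: simple_sum_in => // i ij ci.
by move: ij; rewrite (cell_inj k0 ci cj) eqxx.
Qed.

Lemma step_case k x : (0 < k)%N ->
  (exists2 j, (j <= k.*2)%N & cell k j x) \/ (forall v, step k v x = 0).
Proof.
move=> k0; have [h|h] := pselect (exists2 j, (j <= k.*2)%N & cell k j x).
  by left.
right=> v; apply: simple_sum_out => j jk cj; apply: h; exists j => //.
Qed.

Lemma dist_mid_le k j : (j <= k.*2)%N -> (dist_mid k j <= k)%N.
Proof. rewrite /dist_mid; lia. Qed.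

Lemma normr_atom k j : `|atom k j| = (dist_mid k j)%:R / fluct k.*2.
Proof.
rewrite /atom normrM [X in _ * X]ger0_norm ?invr_ge0 ?powR_ge0//.
congr (_ / _); rewrite /dist_mid; have [kj|/ltnW jk] := leqP k j.
  rewrite (_ : k - j = 0)%N; last by lia.
  by rewrite addn0 natrB// ger0_norm// subr_ge0 ler_nat.
rewrite (_ : j - k = 0)%N; last by lia.
by rewrite add0n natrB// distrC ger0_norm// subr_ge0 ler_nat.
Qed.

Lemma cell_dist k j x : cell k j x -> `|x - atom k j| <= mesh k.
Proof.
rewrite /cell /= in_itv/= => /andP[h1 h2].
by rewrite ger0_norm ?subr_ge0// lerBlDl ltW.
Qed.

(** A point x of the cell of an atom a satisfies |x - a| <= 1, hence
    |x| <= |a| + 1 and x^2 <= 2 a^2 + 2: the Gaussian bound at the atoms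
    passes to the whole cell. *)
Lemma step_dominated (M : R) : 0 <= M -> exists K : R, 0 <= K /\
  forall k x, (0 < k)%N ->
   0 <= step k (relweight k) x /\
   expR (M * `|x|) * step k (relweight k) x <= K * gauss_fun x.
Proof.
move=> M0; have [C hC] := log_ratio_dominated gamma z0 M0.
exists (expR (C + M + 2)); split=> [|k x k0]; first exact: expR_ge0.
have [[j jk cj]|h] := step_case x k0; last first.
  by rewrite h mulr0 mulr_ge0 ?expR_ge0.
rewrite (step_in _ k0 jk cj); split; first exact: expR_ge0.
rewrite /relweight /gauss_fun -!expRD ler_expR.
have := hC k _ k0 (dist_mid_le jk); rewrite -normr_atom /=.
have := le_trans (cell_dist cj) (mesh_le1 k0).
set a := atom k j => ha.
have hx : `|x| <= `|a| + 1.
  by rewrite -(subrK a x) (le_trans (ler_normD _ _))// addrC lerD2l.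
have hM : M * `|x| <= M * `|a| + M by rewrite -[X in _ + X]mulr1 -mulrDr ler_wpM2l.
have h2 : x ^+ 2 <= 2 * `|a| ^+ 2 + 2.
  rewrite real_normK ?num_real//.
  have : (x - a) ^+ 2 <= 1.
    by rewrite -real_normK ?num_real// expr_le1.
  have := sqr_ge0 (x - 2 * a); rewrite !expr2 => ? ?; lra.
by move: hM h2; lra.
Qed.

Lemma cvg_mesh : mesh k @[k --> \oo] --> (0 : R).
Proof.
have -> : mesh = fun k => Num.sqrt (((Num.sqrt k.*2%:R)^-1 : R) ^+ 3).
  apply/funext => k; rewrite exprVn -fluct_sqr -exprVn sqrtr_sqr ger0_norm//.
  exact: mesh_ge0.
have := cvg_sqrt (cvg_exprn (m := 3) (@cvg_inv_sqrt R)).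
by rewrite expr0n/= sqrtr0.
Qed.

Definition index_of k x : nat := Num.truncn (x * fluct k.*2 + k%:R).

(** The atoms cover an interval of half-length k / n^(3/4), of order n^(1/4),
    which eventually contains x. *)
Lemma near_cell x : \forall k \near \oo,
  (index_of k x <= k.*2)%N /\ cell k (index_of k x) x.
Proof.
pose s k : R := fluct k.*2.
have small : \forall k \near \oo, `|x| * s k <= k%:R - 1.
  have h : 2 * `|x| * Num.sqrt (Num.sqrt k.*2%:R)^-1 @[k --> \oo] --> (0 : R).
    have E : 2 * `|x| * Num.sqrt 0 = 0 by rewrite sqrtr0 mulr0.
    rewrite -[X in _ --> X]E.
    exact: (cvgM (cvg_cst _) (cvg_sqrt cvg_inv_sqrt)).
  have /cvgr0_norm_le/(_ (1 / 2)) := h; rewrite divr_gt0// => /(_ isT) h2.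
  near=> k.
  have k2 : (2 <= k)%N by near: k; exists 2%N.
  have n0 : (0 < k.*2)%N by rewrite double_gt0 (leq_trans _ k2).
  have hk : `|2 * `|x| * Num.sqrt (Num.sqrt k.*2%:R)^-1| <= 1 / 2 by near: k.
  rewrite ger0_norm ?mulr_ge0 ?sqrtr_ge0// in hk.
  have sE : s k = k.*2%:R * Num.sqrt (Num.sqrt k.*2%:R)^-1.
    by rewrite sqrt_inv_sqrt// mulrC divfK// pnatr_eq0 -lt0n.
  have kR : 2 <= k%:R :> R by rewrite ler_nat.
  have : k%:R * (2 * `|x| * Num.sqrt (Num.sqrt k.*2%:R)^-1) <= k%:R * (1 / 2).
    by rewrite ler_wpM2l.
  by rewrite sE -mul2n natrM; lra.
near=> k.
  have k0 : (0 < k)%N by near: k; exists 1%N.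
  have xs : `|x| * s k <= k%:R - 1 by near: k.
  have s0 : 0 < s k by rewrite fluct_gt0// double_gt0.
  have h : 0 <= x * s k + k%:R <= k.*2%:R.
    rewrite -mul2n natrM.
    have := ler_norm (x * s k); have := ler_norm (- (x * s k)).
    rewrite normrN normrM (gtr0_norm s0) => h1 h2.
    by apply/andP; split; lra.
  have /andP[h0 h1] := h.
  split; last by apply/cellE => //; exact: truncn_itv.
  rewrite /index_of -ltnS truncn_lt_nat//.
  by rewrite (le_lt_trans h1)// ltr_nat.
Unshelve. all: by end_near. Qed.

(** The quartic is even, so it is enough that the distance of the atom to 0
    converges to |x|. *)
Lemma cvg_step x :
  step k (relweight k) x @[k --> \oo] --> expR (quartic z gamma x).
Proof.
pose s k : R := fluct k.*2.
pose j k := index_of k x.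
have cj := near_cell x.
have dist0 : (dist_mid k (j k))%:R / s k @[k --> \oo] --> `|x|.
  apply/cvgrPdist_le => e e0; near=> k.
  have [jk ck] : (j k <= k.*2)%N /\ cell k (j k) x by near: k.
  rewrite -normr_atom (le_trans (ler_dist_dist _ _))//.
  apply: (le_trans (cell_dist ck)).
  near: k; have /cvgr0_norm_le := cvg_mesh => /(_ _ e0).
  by apply: filterS => k; rewrite ger0_norm ?mesh_ge0.
have := @cvg_log_ratio _ z gamma z0 (fun k => dist_mid k (j k)) _ _ dist0.
have -> : quartic z gamma `|x| = quartic z gamma x.
  by rewrite /quartic (_ : 4 = 2 * 2)%N// !exprM real_normK// num_real.
move=> H; have {}H := cvg_expR (H _).
apply: cvg_trans (H _); last first.
  by apply: filterS cj => k [+ _]; exact: dist_mid_le.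
apply: near_eq_cvg; near=> k.
have k0 : (0 < k)%N by near: k; exists 1%N.
have [jk ck] : (j k <= k.*2)%N /\ cell k (j k) x by near: k.
by rewrite (step_in _ k0 jk ck).
Unshelve. all: by end_near. Qed.

End step_functions.

(** * Convergence of the unnormalized and normalized sums *)

Section dominated.
Context {R : realType}.
Local Notation leb := (@lebesgue_measure R).
Implicit Types (K : R) (f : R -> R).

Lemma gauss_dominated_integrable f K : measurable_fun [set: R] f ->
  (forall x, `|f x| <= K * gauss_fun x) -> leb.-integrable [set: R] (EFin \o f).
Proof.
move=> mf fK.
have gi : leb.-integrable [set: R] (fun x => (K%:E * (gauss_fun x)%:E)%E).
  exact: (@integrableZl _ _ _ leb setT measurableT K (EFin \o gauss_fun)
    integrableT_gauss).
apply: le_integrable gi => //; first exact/measurable_EFinP.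
move=> x _ /=; rewrite lee_fin (le_trans (fK x))// ler_norm//.
Qed.

Lemma gauss_dominated_cvg (f_ : nat -> R -> R) f K :
  (forall k, measurable_fun [set: R] (f_ k)) ->
  (forall x, f_ k x @[k --> \oo] --> f x) ->
  (forall k x, `|f_ k x| <= K * gauss_fun x) ->
  measurable_fun [set: R] f ->
  \int[leb]_x f_ k x @[k --> \oo] --> \int[leb]_x f x.
Proof.
move=> mf_ ff fK mf.
have gi : leb.-integrable [set: R] (fun x => (K%:E * (gauss_fun x)%:E)%E).
  exact: (@integrableZl _ _ _ leb setT measurableT K (EFin \o gauss_fun)
    integrableT_gauss).
have [| | | |fi _ H] := @dominated_convergence _ _ _ leb setT measurableT
  (fun k x => (f_ k x)%:E) (fun x => (f x)%:E)
  (fun x => (K%:E * (gauss_fun x)%:E)%E) _ _ _ gi.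
- by move=> k; apply/measurable_EFinP; exact: mf_.
- exact/measurable_EFinP.
- by apply: aeW => x _; apply: cvg_EFin => //; [exact: nearW|exact: ff].
- by apply: aeW => x k _; rewrite /= lee_fin.
by apply: fine_cvg; rewrite fineK//; exact: integrable_fin_num.
Qed.

End dominated.

Section convergence.
Context {R : realType}.
Variables (z gamma : R).
Hypothesis z0 : 0 < z.
Implicit Types (k j : nat) (x : R).
Local Notation leb := (@lebesgue_measure R).

Definition lim_weight x : R := expR (quartic z gamma x).
Definition disc_weight k x : R := step k (relweight z gamma k) x.
Definition lim_mass : R := \int[leb]_x lim_weight x.
Definition disc_mass k : R := \sum_(j < k.*2.+1) relweight z gamma k j * mesh k.

Lemma measurable_quartic : measurable_fun [set: R] (quartic z gamma).
Proof.
by apply: measurable_funB; apply: measurable_funM => //; exact: measurable_funX.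
Qed.

Lemma measurable_lim_weight : measurable_fun [set: R] lim_weight.
Proof. by apply: measurableT_comp => //; exact: measurable_quartic. Qed.

Lemma measurable_disc_weight k : measurable_fun [set: R] (disc_weight k).
Proof. exact: measurable_step. Qed.

Lemma measurable_expabs (M : R) : measurable_fun [set: R] (fun x => expR (M * `|x|)).
Proof.
apply: measurableT_comp => //; apply: measurable_funM => //.
Qed.

Lemma cvg_disc_weight x : disc_weight k x @[k --> \oo] --> lim_weight x.
Proof. exact: cvg_step. Qed.

(** The Gaussian bound is uniform in k, so it is inherited by the limit. *)
Lemma lim_weight_dominated (M : R) : 0 <= M -> exists K : R, 0 <= K /\
  forall x, expR (M * `|x|) * lim_weight x <= K * gauss_fun x.
Proof.
move=> M0; have [K [K0 HK]] := step_dominated gamma z0 M0.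
exists K; split=> // x.
have h : expR (M * `|x|) * disc_weight k x @[k --> \oo] -->
    expR (M * `|x|) * lim_weight x.
  exact: (cvgM (cvg_cst _) (@cvg_disc_weight x)).
apply: (cvgr_to_le h); exists 1%N => // k /= k0.
by have [_] := HK k x k0.
Qed.

Lemma integrable_exp_lim_weight (M : R) : 0 <= M ->
  leb.-integrable [set: R] (EFin \o (fun x => expR (M * `|x|) * lim_weight x)).
Proof.
move=> M0; have [K [K0 HK]] := lim_weight_dominated M0.
apply: (@gauss_dominated_integrable _ _ K).
  by apply: measurable_funM; [exact: measurable_expabs|exact: measurable_lim_weight].
by move=> x; rewrite ger0_norm ?mulr_ge0 ?expR_ge0.
Qed.

Lemma integrable_lim_weight : leb.-integrable [set: R] (EFin \o lim_weight).
Proof.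
have := integrable_exp_lim_weight (lexx 0); apply: eq_integrable => // x _ /=.
by rewrite mul0r expR0 mul1r.
Qed.

Lemma lim_mass_gt0 : 0 < lim_mass.
Proof.
pose c := expR (- (`|gamma| + `|Defs.coefB z / 12|)).
have c0 : 0 < c by exact: expR_gt0.
pose A (_ : nat) : set R := [set` `[0, 1]].
have mA j : measurable (A j) by exact: measurable_itv.
have lA j : leb (A j) = 1%E.
  by rewrite /A lebesgue_measure_itv/= lte_fin ltr01 oppr0 adde0.
have fA j : (leb (A j) < +oo)%E by have /= -> := lA j; rewrite ltry.
have := @Rintegral_simple_sum _ _ _ leb 1 (fun _ => c) A mA fA.
rewrite big_ord1; have /= -> := lA 0%N; rewrite mulr1 => E.
apply: (lt_le_trans c0); rewrite -E; apply: le_Rintegral => //.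
- exact: integrable_simple_sum.
- exact: integrable_lim_weight.
move=> x _; rewrite /simple_sum big_ord1 indicE.
have [|_] := boolP (x \in _); last by rewrite mulr0 expR_ge0.
rewrite inE /A/= in_itv/= => /andP[x0 x1]; rewrite mulr1 /lim_weight ler_expR /quartic.
have x2 : 0 <= x ^+ 2 <= 1 by rewrite sqr_ge0 expr_le1.
have x4 : 0 <= x ^+ 4 <= 1 by rewrite exprn_ge0// expr_le1.
have h1 : `|gamma * x ^+ 2| <= `|gamma|.
  by rewrite normrM ler_piMr// ger0_norm; case/andP: x2.
have h2 : `|Defs.coefB z / 12 * x ^+ 4| <= `|Defs.coefB z / 12|.
  by rewrite normrM ler_piMr// ger0_norm; case/andP: x4.
move: h1 h2; rewrite !ler_norml => /andP[h1 _] /andP[_ h2].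
by rewrite opprD lerD// lerN2.
Qed.

(** What is used of the functions x |-> e^(a x) cos (b x) and e^(a x) sin (b x)
    with |a|, |b| <= M.  The bounds depend on M only, and this is the source of
    the uniformity in zeta. *)
Definition tame (M : R) (phi : R -> R) : Prop :=
  [/\ measurable_fun [set: R] phi, forall x, `|phi x| <= expR (M * `|x|) &
    forall x y, `|phi x - phi y| <= 2 * M * `|x - y| * expR (M * `|x| + M * `|y|)].

(** A common bound, for all tame functions phi with the same M, of the
    pointwise error between the step function of phi and lim_weight * phi.  The
    first term is the error on the weight, the second one the error of moving
    phi from x to the atom of its cell. *)
Definition defect (M : R) k x : R :=
  expR M * (expR (M * `|x|) * `|disc_weight k x - lim_weight x|) +
  2 * M * expR M * mesh k * (expR (2 * M * `|x|) * lim_weight x).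

Lemma measurable_defect M k : measurable_fun [set: R] (defect M k).
Proof.
apply: measurable_funD; apply: measurable_funM => //; apply: measurable_funM.
- exact: measurable_expabs.
- apply: measurableT_comp => //; apply: measurable_funB.
    exact: measurable_disc_weight.
  exact: measurable_lim_weight.
- exact: measurable_expabs.
- exact: measurable_lim_weight.
Qed.

Lemma defect_ge0 M k x : 0 <= M -> 0 <= defect M k x.
Proof.
by move=> M0; rewrite addr_ge0// ?mulr_ge0 ?expR_ge0 ?mesh_ge0// mulr_ge0 ?expR_ge0.
Qed.

Lemma defect_dominated M : 0 <= M -> exists K : R, 0 <= K /\
  forall k x, (0 < k)%N -> defect M k x <= K * gauss_fun x.
Proof.
move=> M0; have [K1 [K10 H1]] := step_dominated gamma z0 M0.
have [K2 [K20 H2]] := lim_weight_dominated M0.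
have M20 : 0 <= 2 * M by rewrite mulr_ge0.
have [K3 [K30 H3]] := lim_weight_dominated M20.
have e0 := expR_ge0 M.
exists (expR M * (K1 + K2) + 2 * M * expR M * K3); split.
  by rewrite addr_ge0// !mulr_ge0// addr_ge0.
move=> k x k0; have [W0 W1] := H1 k x k0.
rewrite [leRHS]mulrDl; apply: lerD.
  rewrite -mulrA ler_wpM2l// mulrDl.
  apply: le_trans (lerD W1 (H2 x)); rewrite -mulrDr ler_wpM2l ?expR_ge0//.
  by rewrite (le_trans (ler_normB _ _))// ger0_norm// [X in _ + X]ger0_norm ?expR_ge0.
rewrite -[leRHS]mulrA; apply: ler_pM; rewrite ?mulr_ge0 ?expR_ge0 ?mesh_ge0//.
by rewrite ler_piMr ?mulr_ge0// mesh_le1.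
Qed.

Lemma cvg_defect M : 0 <= M -> \int[leb]_x defect M k x @[k --> \oo] --> (0 : R).
Proof.
move=> M0; have [K [K0 HK]] := defect_dominated M0.
rewrite -cvg_shiftS.
have E : \int[leb]_x (0 : R) = 0 by rewrite /Rintegral integral0.
suff : \int[leb]_x defect M k.+1 x @[k --> \oo] --> \int[leb]_x (0 : R).
  by rewrite E.
apply: (@gauss_dominated_cvg _ (fun k x => defect M k.+1 x) _ K) => //.
- by move=> k; exact: measurable_defect.
- move=> x; rewrite (cvg_shiftS (fun k => defect M k x)).
  have E0 : expR M * (expR (M * `|x|) * 0) +
      2 * M * expR M * 0 * (expR (2 * M * `|x|) * lim_weight x) = 0.
    by rewrite !(mulr0, mul0r) addr0.
  have d0 : `|disc_weight k x - lim_weight x| @[k --> \oo] --> (0 : R).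
    have := cvg_norm (cvgB (@cvg_disc_weight x) (cvg_cst (lim_weight x))).
    by rewrite subrr normr0; apply.
  have := cvgD (cvgM (cvg_cst (expR M)) (cvgM (cvg_cst (expR (M * `|x|))) d0))
    (cvgM (cvgM (cvg_cst (2 * M * expR M)) (@cvg_mesh R))
       (cvg_cst (expR (2 * M * `|x|) * lim_weight x))).
  by rewrite E0 => H; apply: H.
- by move=> k x; rewrite ger0_norm ?defect_ge0// HK.
Qed.

Definition atomic k (phi : R -> R) : R :=
  \sum_(j < k.*2.+1) relweight z gamma k j * phi (atom k j) * mesh k.

Lemma atomicE k phi : atomic k phi =
  \int[leb]_x step k (fun j => relweight z gamma k j * phi (atom k j)) x.
Proof. by rewrite Rintegral_step. Qed.

(** Outside the cells the step functions vanish, and the first term of the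
    defect bounds lim_weight * phi itself. *)
Lemma step_defect M phi k x : 0 <= M -> (0 < k)%N -> tame M phi ->
  `|step k (fun j => relweight z gamma k j * phi (atom k j)) x - lim_weight x * phi x|
  <= defect M k x.
Proof.
move=> M0 k0 [_ phi1 phi2]; rewrite /defect /disc_weight.
have W0 : 0 <= lim_weight x by exact: expR_ge0.
have [[j jk cj]|h] := step_case x k0; last first.
  rewrite !h !sub0r normrN normrM [`|lim_weight x|]ger0_norm//.
  rewrite normrN [`|lim_weight x|]ger0_norm//.
  rewrite -[leLHS]addr0 lerD//; last first.
    by rewrite !mulr_ge0 ?expR_ge0 ?mesh_ge0.
  rewrite mulrC mulrA ler_wpM2r// (le_trans (phi1 x))// ler_peMl ?expR_ge0//.
  by rewrite -expR0 ler_expR.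
rewrite !(step_in _ k0 jk cj); set a := atom k j; set w := relweight _ _ _ _.
have -> : w * phi a - lim_weight x * phi x =
  phi a * (w - lim_weight x) + lim_weight x * (phi a - phi x) by ring.
have xa := cell_dist cj; rewrite -/a in xa.
have ax : `|a| <= `|x| + 1.
  have := le_trans xa (mesh_le1 k0); rewrite distrC => h.
  by rewrite -(subrK x a) (le_trans (ler_normD _ _))// addrC lerD2l.
have Max : M * `|a| <= M * `|x| + M by rewrite -[X in _ + X]mulr1 -mulrDr ler_wpM2l.
rewrite (le_trans (ler_normD _ _))// !normrM; apply: lerD.
  rewrite mulrA ler_wpM2r// (le_trans (phi1 a))// -expRD ler_expR.
  by rewrite addrC.
have h : `|phi a - phi x| <= 2 * M * mesh k * (expR M * expR (2 * M * `|x|)).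
  rewrite (le_trans (phi2 a x))//; apply: ler_pM; rewrite ?mulr_ge0 ?expR_ge0//.
    by rewrite ler_wpM2l ?mulr_ge0// distrC.
  by rewrite -expRD ler_expR; lra.
rewrite [`|lim_weight x|]ger0_norm//; apply: (le_trans (ler_wpM2l W0 h)).
by rewrite le_eqVlt; apply/orP; left; apply/eqP; ring.
Qed.

Lemma integrable_tame M phi : 0 <= M -> tame M phi ->
  leb.-integrable [set: R] (EFin \o (fun x => lim_weight x * phi x)).
Proof.
move=> M0 [mphi phi1 _]; have [K [K0 HK]] := lim_weight_dominated M0.
apply: (@gauss_dominated_integrable _ _ K).
  by apply: measurable_funM => //; exact: measurable_lim_weight.
move=> x; apply: le_trans (HK x); rewrite normrM mulrC.
rewrite [`|lim_weight x|]ger0_norm ?expR_ge0//.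
by rewrite ler_wpM2r ?expR_ge0.
Qed.

Lemma integrable_defect M k : 0 <= M -> (0 < k)%N ->
  leb.-integrable [set: R] (EFin \o defect M k).
Proof.
move=> M0 k0; have [K [K0 HK]] := defect_dominated M0.
apply: (@gauss_dominated_integrable _ _ K); first exact: measurable_defect.
by move=> x; rewrite ger0_norm ?defect_ge0// HK.
Qed.

Lemma atomic_defect M phi k : 0 <= M -> (0 < k)%N -> tame M phi ->
  `|atomic k phi - \int[leb]_x (lim_weight x * phi x)| <= \int[leb]_x defect M k x.
Proof.
move=> M0 k0 tphi; rewrite atomicE -RintegralB//; last 2 first.
- exact: integrable_step.
- exact: integrable_tame tphi.
set g := step k _.
have iB : leb.-integrable [set: R] (EFin \o (fun x => g x - lim_weight x * phi x)).
  have := integrableB measurableT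
    (integrable_step k (fun j => relweight z gamma k j * phi (atom k j)))
    (integrable_tame M0 tphi).
  by apply: eq_integrable.
apply: (le_trans (le_normr_Rintegral _ iB)) => //.
apply: le_Rintegral => //.
- exact: integrable_norm.
- exact: integrable_defect.
by move=> x _; exact: step_defect.
Qed.

Lemma tame1 : tame 0 (fun=> 1).
Proof.
split=> //.
- by move=> x; rewrite normr1 mul0r expR0.
- by move=> x y; rewrite subrr normr0 !mulr0 !mul0r.
Qed.

Lemma cvg_disc_mass : disc_mass k @[k --> \oo] --> lim_mass.
Proof.
apply/cvgrPdist_le => e e0.
have /cvgr0_norm_le/(_ _ e0) H := cvg_defect (lexx 0).
near=> k; have k0 : (0 < k)%N by near: k; exists 1%N.
have := atomic_defect (lexx 0) k0 tame1.
have -> : atomic k (fun=> 1) = disc_mass k by apply: eq_bigr => j _; rewrite mulr1.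
have -> : \int[leb]_x (lim_weight x * 1) = lim_mass.
  by apply: eq_Rintegral => x _; rewrite mulr1.
rewrite distrC => /le_trans; apply; apply: le_trans (ler_norm _) _.
by near: k.
Unshelve. all: by end_near. Qed.

Lemma disc_mass_gt0 k : (0 < k)%N -> 0 < disc_mass k.
Proof.
move=> k0; rewrite /disc_mass big_ord_recl/= ltr_wpDr//.
  by apply: sumr_ge0 => j _; rewrite mulr_ge0 ?expR_ge0 ?mesh_ge0.
by rewrite mulr_gt0 ?expR_gt0 ?mesh_gt0.
Qed.

(** The error bound for normalized sums: it combines the defect with the
    convergence of the total mass, and it depends on M but not on phi. *)
Definition rate M k : R :=
  (\int[leb]_x defect M k x) / disc_mass k +
  (\int[leb]_x (expR (M * `|x|) * lim_weight x)) * `|(disc_mass k)^-1 - lim_mass^-1|.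

Lemma cvg_rate M : 0 <= M -> rate M k @[k --> \oo] --> (0 : R).
Proof.
move=> M0; have m0 : lim_mass != 0 by rewrite gt_eqF// lim_mass_gt0.
have iv : (disc_mass k)^-1 @[k --> \oo] --> lim_mass^-1 by exact: (cvgV m0 cvg_disc_mass).
have E : 0 / lim_mass + (\int[leb]_x (expR (M * `|x|) * lim_weight x)) *
    `|lim_mass^-1 - lim_mass^-1| = 0.
  by rewrite mul0r subrr normr0 mulr0 addr0.
have := cvgD (cvgM (cvg_defect M0) iv)
  (cvgM (cvg_cst (\int[leb]_x (expR (M * `|x|) * lim_weight x)))
    (cvg_norm (cvgB iv (cvg_cst lim_mass^-1)))).
by rewrite E => H; apply: H.
Qed.

Lemma atomic_rate M phi k : 0 <= M -> (0 < k)%N -> tame M phi ->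
  `|atomic k phi / disc_mass k - (\int[leb]_x (lim_weight x * phi x)) / lim_mass|
  <= rate M k.
Proof.
move=> M0 k0 tphi; have := atomic_defect M0 k0 tphi.
set a := atomic _ _; set b := \int[_]_x (_ * phi _); set e := \int[_]_x defect _ _ _.
move=> ab; have s0 := disc_mass_gt0 k0.
have -> : a / disc_mass k - b / lim_mass =
  (a - b) / disc_mass k + b * ((disc_mass k)^-1 - lim_mass^-1) by ring.
rewrite (le_trans (ler_normD _ _))// !normrM lerD//.
  by rewrite [`|(disc_mass k)^-1|]gtr0_norm ?invr_gt0// ler_pM2r ?invr_gt0.
rewrite ler_wpM2r//.
have iW := integrable_tame M0 tphi.
apply: (le_trans (le_normr_Rintegral _ iW)) => //.
apply: le_Rintegral => //.
- exact: integrable_norm.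
- exact: integrable_exp_lim_weight.
move=> x _; rewrite normrM mulrC [`|lim_weight x|]ger0_norm ?expR_ge0//.
rewrite ler_wpM2r ?expR_ge0//.
by case: tphi.
Qed.

(** On the cell containing x the step function is the weight times the value
    of f at an atom that converges to x; boundedness of f gives the
    domination. *)
Lemma atomic_weak (f : R -> R) M : continuous f -> (forall x, `|f x| <= M) ->
  atomic k f / disc_mass k @[k --> \oo] --> (\int[leb]_x (lim_weight x * f x)) / lim_mass.
Proof.
move=> cf fM; have m0 : lim_mass != 0 by rewrite gt_eqF// lim_mass_gt0.
have mf : measurable_fun [set: R] f by exact: continuous_measurable_fun.
suff H : atomic k f @[k --> \oo] --> \int[leb]_x (lim_weight x * f x).
  exact: (cvgM H (cvgV m0 cvg_disc_mass)).
have -> : atomic^~ f = fun k =>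
    \int[leb]_x step k (fun j => relweight z gamma k j * f (atom k j)) x.
  by apply/funext => k; exact: atomicE.
rewrite -cvg_shiftS.
have [K [K0 HK]] := step_dominated gamma z0 (lexx 0).
have M0 : 0 <= M by rewrite (le_trans (normr_ge0 (f 0))).
pose fs k := step k (fun j => relweight z gamma k j * f (atom k j)).
apply: (@gauss_dominated_cvg _ (fun k => fs k.+1) _ (K * M)).
- by move=> k; exact: measurable_step.
- move=> x; rewrite (cvg_shiftS (fs^~ x)).
  have ca : atom k (index_of k x) @[k --> \oo] --> x.
    apply/cvgrPdist_le => e e0; near=> k.
    have [jk ck] : (index_of k x <= k.*2)%N /\ cell k (index_of k x) x.
      by near: k; exact: near_cell.
    apply: (le_trans (cell_dist ck)).
    near: k; have /cvgr0_norm_le := @cvg_mesh R => /(_ _ e0).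
    by apply: filterS => k; rewrite ger0_norm ?mesh_ge0.
  have cfa : f (atom k (index_of k x)) @[k --> \oo] --> f x.
    apply: (@continuous_cvg _ _ _ _ _ (fun k => atom k (index_of k x)) f) => //.
    exact: cf.
  have H : disc_weight k x * f (atom k (index_of k x)) @[k --> \oo] -->
      lim_weight x * f x.
    exact: (cvgM (@cvg_disc_weight x) cfa).
  apply: cvg_trans H; apply: near_eq_cvg; near=> k.
  have k0 : (0 < k)%N by near: k; exists 1%N.
  have [jk ck] : (index_of k x <= k.*2)%N /\ cell k (index_of k x) x.
    by near: k; exact: near_cell.
  by rewrite /fs /disc_weight !(step_in _ k0 jk ck).
- move=> k x; have [W0] := HK k.+1 x isT; rewrite mul0r expR0 mul1r => W1.
  have [[j jk cj]|h] := @step_case _ k.+1 x isT; last first.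
    by rewrite /fs h normr0 !mulr_ge0 ?expR_ge0.
  rewrite /fs; move: W0 W1; rewrite !(step_in _ _ jk cj)// => W0 W1.
  rewrite normrM ger0_norm// mulrAC; apply: ler_pM => //.
- by apply: measurable_funM => //; exact: measurable_lim_weight.
Unshelve. all: by end_near. Qed.

End convergence.

(** * Integration against a measure with density *)

Section density.
Context d d' (T : measurableType d) (U : measurableType d') (R : realType).
Variables (mu : {measure set T -> \bar R}) (m : {measure set U -> \bar R}).
Variables (p : T -> U) (rho : T -> R).
Hypothesis mp : measurable_fun [set: T] p.
Hypothesis rho0 : forall x, 0 <= rho x.
Hypothesis mrho : measurable_fun [set: T] rho.
Hypothesis mE : forall A, measurable A -> m A = (\int[mu]_(x in p @^-1` A) (rho x)%:E)%E.
Import HBNNSimple.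

Let density_nnsfun (h : {nnsfun U >-> R}) :
  (\int[m]_x (h x)%:E = \int[mu]_x ((h (p x))%:E * (rho x)%:E))%E.
Proof.
rewrite integralT_nnsfun sintegralE.
have -> : (fun x => (h (p x))%:E * (rho x)%:E)%E = (fun x => \sum_(y \in range h)
    (y%:E * ((\1_(h @^-1` [set y]) (p x))%:E * (rho x)%:E)))%E.
  apply/funext => x; rewrite -EFinM {1}(fimfunE h (p x)) fsbig_finite//= mulr_suml.
  rewrite fsbig_finite//= -sumEFin.
  by apply: eq_bigr => y _; rewrite -!EFinM mulrA.
have mi y : measurable_fun [set: T]
    (fun x => ((\1_(h @^-1` [set y]) (p x))%:E * (rho x)%:E)%E).
  apply: emeasurable_funM; apply/measurable_EFinP => //.
  by apply: measurableT_comp => //; exact: measurable_indic.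
rewrite ge0_integral_fsum//; last 2 first.
- by move=> y; apply: emeasurable_funM => //; exact: mi.
- move=> y x _; rewrite -!EFinM lee_fin indicE.
  have [|_] := boolP (p x \in _); last by rewrite mul0r mulr0.
  by rewrite inE/= => <-; rewrite mul1r mulr_ge0.
apply: eq_fsbigr => y; rewrite inE => -[t _ <-].
rewrite (@ge0_integralZl _ _ _ mu setT measurableT _ (mi (h t)) (h t)%:E); last 2 first.
- by move=> x _; rewrite -EFinM lee_fin mulr_ge0.
- by rewrite lee_fin.
congr (_ * _)%E; rewrite mE//.
rewrite integral_mkcond; apply: eq_integral => x _.
rewrite patchE indicE; case: ifPn => [|/negP].
  by rewrite inE => hx; rewrite mem_set// mul1e.
by rewrite inE => hx; rewrite memNset// mul0e.
Qed.

Let ge0_integral_density (g : U -> \bar R) : measurable_fun [set: U] g ->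
  (forall x, 0 <= g x)%E -> (\int[m]_x g x = \int[mu]_x (g (p x) * (rho x)%:E))%E.
Proof.
move=> mg g0; pose h := nnsfun_approx measurableT mg.
have hg x : (fun n => (h n x)%:E) @ \oo --> g x.
  by apply: cvg_nnsfun_approx.
have hnd x : {homo (fun n => (h n x)%:E) : a b / (a <= b)%N >-> (a <= b)%E}.
  by move=> a b ab; rewrite lee_fin; exact/lefP/nd_nnsfun_approx.
have -> : (\int[m]_x g x = limn (fun n => \int[m]_x (h n x)%:E))%E.
  rewrite -monotone_convergence//.
  - by apply: eq_integral => x _; apply/esym/cvg_lim => //; exact: hg.
  - by move=> n; exact/measurable_EFinP/measurable_funTS.
  - by move=> n x _; rewrite lee_fin.
have -> : (\int[mu]_x (g (p x) * (rho x)%:E) =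
    limn (fun n => \int[mu]_x ((h n (p x))%:E * (rho x)%:E)))%E.
  rewrite -monotone_convergence//.
  - apply: eq_integral => x _; apply/esym/cvg_lim => //.
    by apply: cvgeZr => //; exact: hg.
  - move=> n; apply: emeasurable_funM; apply/measurable_EFinP => //.
    exact: measurableT_comp.
  - by move=> n x _; rewrite -EFinM lee_fin mulr_ge0.
  - by move=> x _ a b ab; rewrite lee_wpmul2r ?lee_fin//; exact: (hnd (p x) _ _ ab).
by under eq_fun do rewrite density_nnsfun.
Qed.

(** The map p allows the density to live on a measurable space other than the
    one carrying m; it is used when both are the real line with its Borel sets,
    presented as two different measurable types. *)
Lemma integral_density (f : U -> R) : measurable_fun [set: U] f ->
  (\int[m]_x (f x)%:E = \int[mu]_x (f (p x) * rho x)%:E)%E.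
Proof.
move=> mf; have mEf : measurable_fun [set: U] (EFin \o f) by exact/measurable_EFinP.
rewrite integralE [RHS]integralE.
rewrite !ge0_integral_density//; last 2 first.
- exact: measurable_funeneg.
- exact: measurable_funepos.
by congr (_ - _)%E; apply: eq_integral => x _;
  rewrite ?funeposE ?funenegE /= -?EFinN -!EFin_max -EFinM maxr_pMl// ?mul0r ?mulNr.
Qed.

End density.

(** * The discrete measures and the limit measure *)

Section measures.
Context {R : realType}.
Variables (z gamma : R).
Hypothesis z0 : 0 < z.
Implicit Types (k j n : nat) (x : R).
Local Notation leb := (@lebesgue_measure R).
Local Notation lim_weight := (lim_weight z gamma).
Local Notation lim_mass := (lim_mass z gamma).

Definition point n j : R := (j%:R - n./2%:R) / n%:R `^ (3 / 4).

Lemma integral_nu_n n (f : R -> R) : measurable_fun [set: R] f ->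
  (\int[nu_n z gamma n]_x (f x)%:E =
   (\sum_(j < n.+1) weight z gamma n j * f (point n j))%:E)%E.
Proof.
have H (g : R -> \bar R) : (forall x, 0 <= g x)%E -> measurable_fun [set: R] g ->
    (\int[nu_n z gamma n]_x g x =
    \sum_(j < n.+1) (weight z gamma n j)%:E * g (point n j))%E.
  move=> g0 mg; rewrite /nu_n ge0_integral_measure_sum//.
  apply: eq_bigr => j _; rewrite ge0_integral_mscale//=.
  by rewrite integral_dirac//= diracT mul1e.
move=> mf; have mEf : measurable_fun [set: R] (EFin \o f) by exact/measurable_EFinP.
rewrite integralE !H//; last 2 first.
- exact: measurable_funeneg.
- exact: measurable_funepos.
under eq_bigr do rewrite funeposE/= -EFin_max -EFinM.
under [in X in (_ - X)%E]eq_bigr do rewrite funenegE/= -?EFinN -EFin_max -EFinM.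
rewrite !sumEFin -EFinB -sumrB; congr EFin; apply: eq_bigr => j _.
rewrite -mulrBr; congr (_ * _); set y := f _.
by case: (leP y 0) => y0; case: (leP (- y) 0) => y1; lra.
Qed.

Lemma Rintegral_nu_n n (f : R -> R) : measurable_fun [set: R] f ->
  \int[nu_n z gamma n]_x f x = \sum_(j < n.+1) weight z gamma n j * f (point n j).
Proof. by move=> mf; rewrite /Rintegral integral_nu_n. Qed.

Lemma partZ1 n : partZ z gamma n 1 = \sum_(j < n.+1) pqC z gamma n j.
Proof.
rewrite /partZ expr1n invr1 mul1r horner_poly.
by apply: eq_bigr => j _; rewrite expr1n mulr1.
Qed.

Lemma pqC_relweight k j : (j <= k.*2)%N ->
  pqC z gamma k.*2 j = pqC z gamma k.*2 k * relweight z gamma k j.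
Proof.
move=> jk; rewrite /relweight /dist_mid; have [kj|/ltnW kj] := leqP k j.
  rewrite (_ : k - j = 0)%N; last by lia.
  rewrite addn0 -pqC_upE//; last by lia.
  by congr pqC; lia.
rewrite (_ : j - k = 0)%N; last by lia.
rewrite add0n -pqC_downE//; last by lia.
by congr pqC; lia.
Qed.

Lemma weight_relweight k j : (0 < k)%N -> (j <= k.*2)%N ->
  weight z gamma k.*2 j = relweight z gamma k j * mesh k / disc_mass z gamma k.
Proof.
move=> k0 jk; have n0 : (0 < k.*2)%N by rewrite double_gt0.
have m0 : 0 < mesh k :> R by exact: mesh_gt0.
rewrite /weight partZ1 pqC_relweight//.
rewrite (eq_bigr (fun i : 'I_k.*2.+1 =>
  pqC z gamma k.*2 k * relweight z gamma k i)); last first.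
  by move=> i _; rewrite pqC_relweight// -ltnS.
rewrite -mulr_sumr /disc_mass -mulr_suml -mulf_div divff ?mul1r; last first.
  by rewrite gt_eqF// pqC_gt0// -addnn leq_addr.
by rewrite -mulf_div divff ?mulr1// gt_eqF.
Qed.

Lemma pointE k j : point k.*2 j = atom k j :> R.
Proof. by rewrite /point doubleK. Qed.

Lemma Rintegral_nu_even k (f : R -> R) : (0 < k)%N -> measurable_fun [set: R] f ->
  \int[nu_n z gamma k.*2]_x f x = atomic z gamma k f / disc_mass z gamma k.
Proof.
move=> k0 mf; rewrite Rintegral_nu_n// /atomic mulr_suml; apply: eq_bigr => j _.
have jk : (j <= k.*2)%N by rewrite -ltnS.
by rewrite (weight_relweight k0 jk) pointE; ring.
Qed.

Lemma nu_n_total n : (0 < n)%N -> nu_n z gamma n [set: R] = 1%E.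
Proof.
move=> n0; rewrite -[LHS]mul1e -integral_cst//.
rewrite (integral_nu_n _ (measurable_cst (1 : R))); congr EFin.
under eq_bigr do rewrite mulr1.
rewrite -mulr_suml -partZ1 divff// partZ1 gt_eqF// big_ord_recl/=.
rewrite ltr_wpDr ?pqC_gt0//.
by apply: sumr_ge0 => j _; exact: pqC_ge0.
Qed.

Lemma integralI0 : integralI z gamma 0 = lim_mass%:C%C.
Proof.
rewrite /integralI /cintegral; congr (_ +i* _)%C.
  by apply: eq_Rintegral => x _; rewrite /cexp /= !mul0r !addr0 ?subrr ?add0r cos0 mulr1.
rewrite /Rintegral integral0_eq// => x _.
by rewrite /cexp /= !mul0r !addr0 ?subrr ?add0r sin0 mulr0.
Qed.

Lemma nu_densityE x : nu_density z gamma x = lim_mass^-1 * lim_weight x.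
Proof. by rewrite /nu_density integralI0. Qed.

Lemma integral_nu_lim (f : R -> R) : measurable_fun [set: R] f ->
  (\int[nu_lim z gamma]_x (f x)%:E = \int[leb]_x (f x * nu_density z gamma x)%:E)%E.
Proof.
move=> mf.
apply: (@integral_density _ _ (measurableTypeR R) R R leb (nu_lim z gamma) idfun
  (nu_density z gamma)) => //.
- by move=> _ A mA; rewrite setTI; exact: mA.
- exact: nu_density_ge0.
- exact: measurable_nu_density.
Qed.

Lemma Rintegral_nu_lim (f : R -> R) : measurable_fun [set: R] f ->
  leb.-integrable [set: R] (EFin \o (fun x => lim_weight x * f x)) ->
  \int[nu_lim z gamma]_x f x = (\int[leb]_x (lim_weight x * f x)) / lim_mass.
Proof.
move=> mf intf; rewrite /Rintegral integral_nu_lim// mulrC -RintegralZl//.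
rewrite /Rintegral; congr fine; apply: eq_integral => x _; congr EFin.
by rewrite nu_densityE; ring.
Qed.

Lemma nu_lim_total : nu_lim z gamma [set: R] = 1%E.
Proof.
rewrite -[LHS]mul1e -integral_cst// (integral_nu_lim (measurable_cst (1 : R))).
under eq_integral do rewrite mul1r nu_densityE EFinM.
have iW := integrable_lim_weight gamma z0; have m0 := lim_mass_gt0 gamma z0.
rewrite integralZl// -[X in (_ * X)%E]fineK; last exact: integrable_fin_num.
by rewrite -EFinM mulVf// gt_eqF.
Qed.

Lemma nu_rate M phi k : 0 <= M -> (0 < k)%N -> tame M phi ->
  `|\int[nu_n z gamma k.*2]_x phi x - \int[nu_lim z gamma]_x phi x| <=
  rate z gamma M k.
Proof.
move=> M0 k0 tphi; have [mphi _ _] := tphi.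
rewrite Rintegral_nu_even// Rintegral_nu_lim//; last exact: integrable_tame tphi.
exact: atomic_rate.
Qed.

Lemma nu_weak (f : R -> R) : continuous f -> (exists M : R, forall x, `|f x| <= M) ->
  \int[nu_n z gamma k.*2]_x f x @[k --> \oo] --> \int[nu_lim z gamma]_x f x.
Proof.
move=> cf [M fM]; have mf : measurable_fun [set: R] f by exact: continuous_measurable_fun.
have H := @atomic_weak _ z gamma z0 f M cf fM.
rewrite Rintegral_nu_lim//.
  apply: cvg_trans H; apply: near_eq_cvg; exists 1%N => // k /= k0.
  by rewrite Rintegral_nu_even.
have [K [K0 HK]] := lim_weight_dominated gamma z0 (lexx 0).
apply: (@gauss_dominated_integrable _ _ (K * M)).
  by apply: measurable_funM => //; exact: measurable_lim_weight.
move=> x; have := HK x; rewrite mul0r expR0 mul1r => WK.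
by rewrite normrM ger0_norm ?expR_ge0// mulrAC ler_pM ?expR_ge0.
Qed.

End measures.

Section tame_exponentials.
Context {R : realType}.
Implicit Types (a b M : R).

Lemma tame_derive (f f' : R -> R) M : 0 <= M ->
  (forall x : R, is_derive x 1 f (f' x)) ->
  (forall x, `|f x| <= expR (M * `|x|)) ->
  (forall x, `|f' x| <= 2 * M * expR (M * `|x|)) -> tame M f.
Proof.
move=> M0 df f1 f2.
have cf : continuous f.
  move=> x; apply: differentiable_continuous; apply/derivable1_diffP.
  by have ? := df x; exact: ex_derive.
split=> //; first exact: continuous_measurable_fun.
have key x y : x <= y -> `|f x - f y| <= 2 * M * `|x - y| * expR (M * `|x| + M * `|y|).
  move=> xy; have cs : {within `[x, y], continuous f} by exact: continuous_subspaceT.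
  have [c] := @MVT_segment R f f' x y xy (fun c _ => df c) cs.
  rewrite in_itv/= => /andP[xc cy] E.
  rewrite distrC E normrM (distrC x) mulrAC; apply: ler_pM => //.
  rewrite (le_trans (f2 c))// ler_wpM2l ?mulr_ge0// ler_expR -mulrDr ler_wpM2l//.
  have := ler_norm y; have := ler_norm (- x); rewrite normrN.
  have := normr_ge0 x; have := normr_ge0 y.
  by rewrite ler_norml; move=> *; apply/andP; split; lra.
move=> x y; have [xy|/ltW yx] := leP x y; first exact: key.
by rewrite distrC (distrC x) [X in expR X]addrC key.
Qed.

Lemma ler_norm_mul_abs (a M x : R) : `|a| <= M -> a * x <= M * `|x|.
Proof.
by move=> aM; rewrite (le_trans (ler_norm _))// normrM ler_wpM2r.
Qed.

Lemma normr_cos_le1 (x : R) : `|cos x| <= 1.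
Proof. by rewrite ler_norml cos_geN1 cos_le1. Qed.

Lemma normr_sin_le1 (x : R) : `|sin x| <= 1.
Proof. by rewrite ler_norml sin_geN1 sin_le1. Qed.

Lemma tame_cos a b M : `|a| <= M -> `|b| <= M ->
  tame M (fun x => expR (a * x) * cos (b * x)).
Proof.
move=> aM bM; have M0 : 0 <= M by rewrite (le_trans (normr_ge0 a)).
apply: (@tame_derive _
  (fun x => expR (a * x) * (a * cos (b * x) - b * sin (b * x)))) => // x.
- have dexp : is_derive x 1 (fun x => expR (a * x)) (expR (a * x) * a).
    apply: (@is_derive1_comp _ (@expR R) (fun x => a * x)).
    by apply: is_derive_eq; rewrite /GRing.scale/= mulr1; lra.
  have dcos : is_derive x 1 (fun x => cos (b * x)) (- sin (b * x) * b).
    apply: (@is_derive1_comp _ (@cos R) (fun x => b * x)).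
    by apply: is_derive_eq; rewrite /GRing.scale/= mulr1; lra.
  by apply: is_derive_eq; rewrite /GRing.scale/=; ring.
- rewrite normrM -[leRHS]mulr1; apply: ler_pM => //; last exact: normr_cos_le1.
  by rewrite ger0_norm ?expR_ge0// ler_expR ler_norm_mul_abs.
rewrite normrM mulrC; apply: ler_pM => //.
  rewrite (le_trans (ler_normB _ _))// mulrDl mul1r lerD// normrM -[leRHS]mulr1 ler_pM//.
    exact: normr_cos_le1.
  exact: normr_sin_le1.
by rewrite ger0_norm ?expR_ge0// ler_expR ler_norm_mul_abs.
Qed.

Lemma tame_sin a b M : `|a| <= M -> `|b| <= M ->
  tame M (fun x => expR (a * x) * sin (b * x)).
Proof.
move=> aM bM; have M0 : 0 <= M by rewrite (le_trans (normr_ge0 a)).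
apply: (@tame_derive _
  (fun x => expR (a * x) * (a * sin (b * x) + b * cos (b * x)))) => // x.
- have dexp : is_derive x 1 (fun x => expR (a * x)) (expR (a * x) * a).
    apply: (@is_derive1_comp _ (@expR R) (fun x => a * x)).
    by apply: is_derive_eq; rewrite /GRing.scale/= mulr1; lra.
  have dsin : is_derive x 1 (fun x => sin (b * x)) (cos (b * x) * b).
    apply: (@is_derive1_comp _ (@sin R) (fun x => b * x)).
    by apply: is_derive_eq; rewrite /GRing.scale/= mulr1; lra.
  by apply: is_derive_eq; rewrite /GRing.scale/=; ring.
- rewrite normrM -[leRHS]mulr1; apply: ler_pM => //; last exact: normr_sin_le1.
  by rewrite ger0_norm ?expR_ge0// ler_expR ler_norm_mul_abs.
rewrite normrM mulrC; apply: ler_pM => //.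
  rewrite (le_trans (ler_normD _ _))// mulrDl mul1r lerD// normrM -[leRHS]mulr1 ler_pM//.
    exact: normr_sin_le1.
  exact: normr_cos_le1.
by rewrite ger0_norm ?expR_ge0// ler_expR ler_norm_mul_abs.
Qed.

End tame_exponentials.

(** * Moment generating functions on the complex plane *)

Section complex_side.
Context {R : realType}.
Implicit Types (w : R[i]) (a b e : R).

Lemma norm_complex_le w e :
  `|complex.Re w| + `|complex.Im w| <= e -> `|w| <= e%:C.
Proof.
move=> h; rewrite normc_def lecR (le_trans _ h)//.
rewrite -[leRHS]ger0_norm ?addr_ge0// -sqrtr_sqr ler_wsqrtr//.
rewrite sqrrD !real_normK ?num_real// -addrA lerD2l lerDr.
by rewrite mulrn_wge0// mulr_ge0.
Qed.

Lemma complex_gt0P (e : R[i]) : 0 < e -> 0 < complex.Re e /\ e = (complex.Re e)%:C.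
Proof.
by case: e => x y; rewrite ltcE /= => /andP[/eqP -> x0].
Qed.

Lemma norm_Re_le w : `|complex.Re w| <= complex.Re `|w|.
Proof. by have := normc_ge_Re w; rewrite normc_def lecR. Qed.

Lemma norm_Im_le w : `|complex.Im w| <= complex.Re `|w|.
Proof. by rewrite normc_def /= -sqrtr_sqr ler_wsqrtr// lerDr sqr_ge0. Qed.

Lemma Re_cexp w (x : R) : complex.Re (cexp (w * x%:C)) =
  expR (complex.Re w * x) * cos (complex.Im w * x).
Proof. by case: w => a b; rewrite /cexp /= !mulr0 subr0 add0r. Qed.

Lemma Im_cexp w (x : R) : complex.Im (cexp (w * x%:C)) =
  expR (complex.Re w * x) * sin (complex.Im w * x).
Proof. by case: w => a b; rewrite /cexp /= !mulr0 subr0 add0r. Qed.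

Lemma cintegral_cexp (m : {measure set R -> \bar R}) w :
  cintegral m (fun x : R => cexp (w * x%:C)) =
  (\int[m]_x (expR (complex.Re w * x) * cos (complex.Im w * x))) +i*
  (\int[m]_x (expR (complex.Re w * x) * sin (complex.Im w * x))).
Proof.
by congr (_ +i* _); apply: eq_Rintegral => x _; rewrite ?Re_cexp ?Im_cexp.
Qed.

End complex_side.

Section even_filter.

#[export] Instance even_infty_filter : Filter even_infty.
Proof. exact: within_filter. Qed.

Lemma near_even (P : nat -> Prop) :
  (\forall k \near \oo, P k.*2) -> \forall n \near even_infty, P n.
Proof.
move=> [N _ HN]; exists N.*2 => // n /= Nn odd_n.
rewrite -[n]odd_double_half (negbTE odd_n) add0n; apply: HN => /=.
by rewrite -(doubleK N) half_leq.
Qed.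

Lemma cvg_even {T : topologicalType} (u : nat -> T) (l : T) :
  u k.*2 @[k --> \oo] --> l -> u n @[n --> even_infty] --> l.
Proof. by move=> ul A /ul; exact: near_even. Qed.

End even_filter.

Section generating_functions.
Context {R : realType}.
Variables (z gamma : R).
Hypothesis z0 : 0 < z.
Implicit Types (w : R[i]) (k n : nat).

Definition mgf_n n w : R[i] :=
  cintegral (nu_n z gamma n) (fun x : R => cexp (w * x%:C)).
Definition mgf w : R[i] :=
  cintegral (nu_lim z gamma) (fun x : R => cexp (w * x%:C)).

(** The real and imaginary parts are integrals of tame functions, which gives
    the factor 2. *)
Lemma mgf_rate (M : R) w k : (0 < k)%N -> complex.Re `|w| <= M ->
  `|mgf_n k.*2 w - mgf w| <= (2 * rate z gamma M k)%:C.
Proof.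
move=> k0 wM; have M0 : 0 <= M.
  by apply: le_trans wM; rewrite normc_def sqrtr_ge0.
have aM := le_trans (norm_Re_le w) wM; have bM := le_trans (norm_Im_le w) wM.
apply: norm_complex_le; rewrite mulr2n mulrDl mul1r.
rewrite /mgf_n /mgf !cintegral_cexp /=.
by apply: lerD; apply: nu_rate => //; [exact: tame_cos|exact: tame_sin].
Qed.

Lemma cvg_rate2 (M : R) : 0 <= M -> 2 * rate z gamma M k @[k --> \oo] --> (0 : R).
Proof.
move=> M0; have := cvgM (cvg_cst (2 : R)) (@cvg_rate _ z gamma z0 _ M0).
by rewrite mulr0 => H; apply: H.
Qed.

Lemma rate_ge0 (M : R) k : (0 < k)%N -> 0 <= M -> 0 <= 2 * rate z gamma M k.
Proof.
move=> k0 M0; have : complex.Re `|0 : R[i]| <= M by rewrite normr0.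
by move=> /(mgf_rate k0); rewrite normc_def lecR; apply: le_trans; exact: sqrtr_ge0.
Qed.

Lemma near_mgf (M e : R) : 0 <= M -> 0 < e ->
  \forall n \near even_infty, forall w, complex.Re `|w| <= M ->
    `|mgf_n n w - mgf w| <= e%:C.
Proof.
move=> M0 e0; apply: near_even.
have h := cvg_rate2 M0.
have /cvgr0_norm_le/(_ _ e0) H := h.
near=> k => w wM; have k0 : (0 < k)%N by near: k; exists 1%N.
apply: (le_trans (mgf_rate k0 wM)); rewrite lecR (le_trans (ler_norm _))//.
by near: k.
Unshelve. all: by end_near. Qed.

(** The norm of C takes its values in C; its real part is a continuous real
    function, whose image of a compact set is bounded. *)
Lemma compact_complex_bounded (Omega : set R[i]) : compact Omega ->
  exists M : R, 0 <= M /\ forall w, Omega w -> complex.Re `|w| <= M.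
Proof.
move=> cO; pose f w : R := complex.Re `|w|.
have cf : continuous f.
  move=> w; have FF : Filter (nbhs w) by exact: nbhs_filter.
  apply/(@cvgrPdist_lt _ _ _ _ FF) => e e0.
  apply/nbhs_ballP; exists e%:C; first by rewrite /= ltcR.
  move=> t; rewrite -ball_normE /= => wt.
  have : `|(`|w| - `|t|)| < e%:C by apply: le_lt_trans wt; exact: ler_dist_dist.
  rewrite /f (normc_def w) (normc_def t) -rmorphB/= normc_def/= ltcR.
  by rewrite expr0n/= addr0 sqrtr_sqr.
have [] := compact_bounded (continuous_compact (continuous_subspaceT cf) cO).
move=> M [_ /(_ (M + 1))]; rewrite ltrDl ltr01 => /(_ isT) H.
exists (`|M| + 1); split; first by rewrite addr_ge0.
move=> w Ow; have := H (f w) (ex_intro2 _ _ w Ow erefl).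
by move=> /(le_trans (ler_norm _)) /le_trans; apply; rewrite lerD2r ler_norm.
Qed.

Lemma mgf_uniform (Omega : set R[i]) : compact Omega ->
  sup_modulus Omega (fun w => mgf_n n w - mgf w) @[n --> even_infty] --> 0%E.
Proof.
move=> /compact_complex_bounded[M [M0 OM]].
apply: cvg_even; set s := fun k => _.
have h := cvg_rate2 M0.
apply: (@squeeze_cvge _ _ _ _ (fun=> 0%E) _ (fun k => (2 * rate z gamma M k)%:E)).
- near=> k; have k0 : (0 < k)%N by near: k; exists 1%N.
  apply/andP; split; first by apply: ereal_sup_ubound; left.
  apply: ge_ereal_sup => _ [->|[w Ow <-]].
    by rewrite lee_fin rate_ge0.
  have := mgf_rate k0 (OM _ Ow).
  by rewrite normc_def lecR lee_fin.
- exact: cvg_cst.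
- by apply: cvg_EFin => //; exact: nearW.
Unshelve. all: by end_near. Qed.

Lemma mgf_pointwise w : mgf_n n w @[n --> even_infty] --> mgf w.
Proof.
apply/cvgrPdist_le => e /complex_gt0P[e0 ->].
have M0 : 0 <= complex.Re `|w| by rewrite normc_def sqrtr_ge0.
by apply: filterS (near_mgf M0 e0) => n /(_ w (lexx _)); rewrite distrC.
Qed.

Lemma integralI_mgf w : integralI z gamma w / integralI z gamma 0 = mgf w.
Proof.
have m0 := lim_mass_gt0 gamma z0.
rewrite integralI0 /mgf cintegral_cexp /integralI /cintegral.
have -> : (\int[lebesgue_measure]_x
    complex.Re (cexp (w * x%:C + (quartic z gamma x)%:C))) =
    \int[lebesgue_measure]_x (lim_weight z gamma x *
      (expR (complex.Re w * x) * cos (complex.Im w * x))).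
  apply: eq_Rintegral => x _; case: w => a b; rewrite /cexp /=.
  by rewrite !mulr0 subr0 !addr0 add0r expRD /lim_weight; ring.
have -> : (\int[lebesgue_measure]_x
    complex.Im (cexp (w * x%:C + (quartic z gamma x)%:C))) =
    \int[lebesgue_measure]_x (lim_weight z gamma x *
      (expR (complex.Re w * x) * sin (complex.Im w * x))).
  apply: eq_Rintegral => x _; case: w => a b; rewrite /cexp /=.
  by rewrite !mulr0 subr0 !addr0 add0r expRD /lim_weight; ring.
have M0 : 0 <= complex.Re `|w| by rewrite normc_def sqrtr_ge0.
have tc := tame_cos (norm_Re_le w) (norm_Im_le w).
have ts := tame_sin (norm_Re_le w) (norm_Im_le w).
rewrite !Rintegral_nu_lim//; last 4 first.
- by case: ts.
- exact: integrable_tame ts.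
- by case: tc.
- exact: integrable_tame tc.
rewrite -(fmorphV (real_complex R)) /=.
set a := \int[_]_x _; set b := \int[_]_x _.
by apply/eqP; rewrite eq_complex /= !mulr0 subr0 add0r !eqxx.
Qed.

(** A function of a variable with finitely many values is a combination of
    indicators of its level sets. *)
Lemma cintegral_RV (d : measure_display) (T : measurableType d)
    (P : probability T R) (K : {RV P >-> nat}) n (g : nat -> R[i]) :
  (forall t, (K t <= n)%N) ->
  (forall k, (k <= n)%N -> distribution P K [set k] = (weight z gamma n k)%:E) ->
  cintegral P (fun t => g (K t)) =
  (\sum_(j < n.+1) weight z gamma n j * complex.Re (g j)) +i*
  (\sum_(j < n.+1) weight z gamma n j * complex.Im (g j)).
Proof.
move=> Kn PK.
have key (f : nat -> R) :
    \int[P]_t f (K t) = \sum_(j < n.+1) weight z gamma n j * f j.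
  pose A j : set T := K @^-1` [set j].
  have mA j : measurable (A j) by rewrite -[A j]setTI; exact: measurable_funP.
  have fA j : (P (A j) < +oo)%E.
    by rewrite (le_lt_trans (probability_le1 P (mA j)))// ltry.
  transitivity (\int[P]_t simple_sum n.+1 f A t).
    apply: eq_Rintegral => t _; rewrite (@simple_sum_in _ _ _ _ _ _ (K t))//.
    - by move=> i /eqP iK Ki; apply: iK.
    - by rewrite ltnS.
  rewrite Rintegral_simple_sum//; apply: eq_bigr => j _.
  have jn : (j <= n)%N by rewrite -ltnS.
  by have := PK _ jn; rewrite /distribution /pushforward/= /A => ->; rewrite mulrC.
by rewrite /cintegral (key (fun j => complex.Re (g j))) (key (fun j => complex.Im (g j))).
Qed.

Lemma mgf_nE n w : mgf_n n w =
  (\sum_(j < n.+1) weight z gamma n j * complex.Re (cexp (w * (point n j)%:C))) +i*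
  (\sum_(j < n.+1) weight z gamma n j * complex.Im (cexp (w * (point n j)%:C))).
Proof.
have tc := tame_cos (norm_Re_le w) (norm_Im_le w).
have ts := tame_sin (norm_Re_le w) (norm_Im_le w).
rewrite /mgf_n cintegral_cexp; congr (_ +i* _).
  rewrite Rintegral_nu_n; last by case: tc.
  by apply: eq_bigr => j _; rewrite Re_cexp.
rewrite Rintegral_nu_n; last by case: ts.
by apply: eq_bigr => j _; rewrite Im_cexp.
Qed.

(** For even n, (n - 2 j) / n^(3/4) is -2 times the j-th atom. *)
Lemma magnetization_mgf (d : measure_display) (T : measurableType d)
    (P : probability T R) (K : {RV P >-> nat}) n tau : ~~ odd n ->
  (forall t, (K t <= n)%N) ->
  (forall k, (k <= n)%N -> distribution P K [set k] = (weight z gamma n k)%:E) ->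
  cintegral P (fun t =>
    cexp (tau * ((n%:R - 2 * (K t)%:R) / n%:R `^ (3 / 4))%:C)) =
  mgf_n n (- 2 * tau).
Proof.
move=> en Kn PK.
rewrite (@cintegral_RV _ _ _ K n (fun j =>
  cexp (tau * ((n%:R - 2 * j%:R) / n%:R `^ (3 / 4))%:C)))//.
rewrite mgf_nE.
have E j : tau * ((n%:R - 2 * j%:R) / n%:R `^ (3 / 4))%:C = - 2 * tau * (point n j)%:C.
  have -> : (n%:R - 2 * j%:R) / n%:R `^ (3 / 4) = - 2 * point n j :> R.
    have nE : n%:R = 2 * (n./2)%:R :> R.
      by rewrite -natrM mul2n -[in LHS](odd_double_half n) (negbTE en).
    by rewrite /point; set s := _ `^ _; rewrite nE; ring.
  by rewrite rmorphM/= rmorphN/= rmorph_nat; ring.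
by under eq_bigr do rewrite E; under [X in _ +i* X]eq_bigr do rewrite E.
Qed.

End generating_functions.

(** * The convergence theorem *)

Theorem corollary3p6 (R : realType) (z gamma : R) (hz : 0 < z) :
  (* nu_n and nu are probability measures *)
  (forall n : nat, (0 < n)%N -> ~~ odd n -> nu_n z gamma n [set: R] = 1%E) /\
  nu_lim z gamma [set: R] = 1%E /\
  (* uniform convergence of moment generating functions on compact sets *)
  (forall Omega : set R[i], compact Omega ->
    sup_modulus Omega (fun zeta : R[i] =>
        cintegral (nu_n z gamma n) (fun x : R => cexp (zeta * x%:C))
        - cintegral (nu_lim z gamma) (fun x : R => cexp (zeta * x%:C)))
      @[n --> even_infty] --> 0%E) /\
  (* convergence of characteristic functions *)
  (forall s : R,
    cintegral (nu_n z gamma n) (fun x : R => cexp ('i%C * s%:C * x%:C))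
      @[n --> even_infty] -->
    cintegral (nu_lim z gamma) (fun x : R => cexp ('i%C * s%:C * x%:C))) /\
  weakly_cvg even_infty (nu_n z gamma) (nu_lim z gamma) /\
  (* the formulation with the magnetization M_n = n - 2 K_n *)
  (forall (d : nat -> measure_display) (T : forall n, measurableType (d n))
      (P : forall n, probability (T n) R) (K : forall n, {RV (P n) >-> nat}),
    (forall n, (0 < n)%N -> ~~ odd n ->
      (forall t, (K n t <= n)%N) /\
      (forall k, (k <= n)%N -> distribution (P n) (K n) [set k] =
        (pqC z gamma n k / partZ z gamma n 1)%:E)) ->
    locally_uniformly_cvg even_infty
      (fun n tau => cintegral (P n) (fun t : T n =>
        cexp (tau * ((n%:R - 2 * (K n t)%:R) / n%:R `^ (3 / 4))%:C)))
      (fun tau => integralI z gamma (- 2 * tau) / integralI z gamma 0)).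
Proof.
split; first by move=> n n0 _; exact: nu_n_total.
split; first exact: nu_lim_total.
split; first by move=> Omega cO; exact: mgf_uniform.
split; first by move=> s; exact: mgf_pointwise.
split; first by move=> f cf bf; apply: cvg_even; exact: nu_weak.
move=> d T P K PK w.
exists (ball w (1 : R[i])); first exact: nbhsx_ballx.
move=> A /uniform_nbhs[E [entE EA]].
have [e /complex_gt0P[e0 eE] HE] : exists2 e : R[i], 0 < e &
    forall x y : R[i], `|x - y| < e -> E (x, y).
  move: entE; rewrite -entourage_ballE => -[e e0 He]; exists e => // x y xy.
  by apply: He; rewrite /= -ball_normE.
(* For tau within 1 of w, the argument -2 tau has modulus at most M. *)
pose M : R := 2 * (complex.Re `|w| + 1).
have M0 : 0 <= M by rewrite mulr_ge0// addr_ge0// normc_def sqrtr_ge0.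
have pos : \forall n \near even_infty, (0 < n)%N /\ ~~ odd n.
  by exists 1%N.
have e20 : 0 < complex.Re e / 2 by rewrite divr_gt0.
have H := near_mgf gamma hz M0 e20.
apply: filterS2 pos H => n [n0 en] Hn.
have [Kn PKn] := PK n n0 en.
apply: EA => tau wtau; apply: HE.
rewrite (magnetization_mgf tau en Kn PKn) integralI_mgf// distrC.
apply: (le_lt_trans (Hn _ _)); last first.
  by rewrite eE ltcR /= ltr_pdivrMr// ltr_pMr// ltr1n.
have : `|- 2 * tau| <= M%:C.
  rewrite normrM normrN normr_nat.
  move: wtau; rewrite -ball_normE /= distrC => wtau.
  have -> : M%:C = 2 * (`|w| + 1).
    rewrite mulr_natl mulr2n /M mulr_natl mulr2n normc_def.
    by apply/eqP; rewrite eq_complex /= !addr0 !eqxx.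
  rewrite ler_pM2l// -lerBlDl (le_trans (lerB_dist _ _))// ltW//.
by rewrite normc_def lecR.
Qed.
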